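(* Let $w\in\mathbb{R}$ with $w>0$, let $b\in\mathbb{C}$, let $\sigma\in\mathbb{R}$ with $0<\sigma<\Re(b)+1$, and let $a\in\mathbb{C}\setminus\{0\}$ with $-\pi<\arg(a)<\pi$. Then $$\frac{1}{2\pi i\,\Gamma(b+1)}\int_{\sigma-i\infty}^{\sigma+i\infty}a^{-v}\,\Gamma(v)\,\Gamma(b+1-v)\,\eta\!\left(b+1-v,\,w+\tfrac12\right)dv=\eta\!\left(b+1,\,a+w+\tfrac12\right).$$
   Context: $\eta(s,a)$ is the alternating Hurwitz zeta function, $\eta(s,a)=\sum_{k=0}^{\infty}(-1)^k/(k+a)^s$ for $\Re(s)>0$. Powers of complex numbers are taken with the principal branch; integration is along the vertical line $\Re(v)=\sigma$. *)

(* Defs.v *)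
From HB Require Import structures.
From mathcomp Require Import all_boot all_order all_algebra.
From mathcomp Require Import all_classical all_reals all_analysis.
From mathcomp Require Export complex.

Set Implicit Arguments.
Unset Strict Implicit.
Unset Printing Implicit Defensive.

Import Order.TTheory GRing.Theory Num.Theory.
Import numFieldNormedType.Exports.

Local Open Scope classical_set_scope.
Local Open Scope ring_scope.
Local Open Scope complex_scope.

(* Principal argument, with values in ]-pi, pi]; carg 0 is a junk value. *)
Definition carg (R : realType) (z : R[i]) : R :=
  let: x +i* y := z in
  let theta := acos (x / Num.sqrt (x ^+ 2 + y ^+ 2)) in
  if 0 <= y then theta else - theta.

Definition cexp (R : realType) (z : R[i]) : R[i] :=
  let: x +i* y := z in (expR x)%:C * (cos y +i* sin y).

Definition clog (R : realType) (z : R[i]) : R[i] :=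
  let: x +i* y := z in ln (Num.sqrt (x ^+ 2 + y ^+ 2)) +i* carg z.

(* Principal branch of z ^ s, meaningful for z != 0. *)
Definition cpow (R : realType) (z s : R[i]) : R[i] := cexp (s * clog z).

Definition cintegrable (R : realType) (D : set R) (f : R -> R[i]) : Prop :=
  (@lebesgue_measure R).-integrable D (fun t => (complex.Re (f t))%:E) /\
  (@lebesgue_measure R).-integrable D (fun t => (complex.Im (f t))%:E).

Definition cintegral (R : realType) (D : set R) (f : R -> R[i]) : R[i] :=
  (\int[@lebesgue_measure R]_(t in D) complex.Re (f t)) +i*
  (\int[@lebesgue_measure R]_(t in D) complex.Im (f t)).

(* The line Re v = sigma is parametrized upwards by v = sigma + i t, so that
   dv = i dt. *)
Definition vline_integrable (R : realType) (sigma : R) (f : R[i] -> R[i]) :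
    Prop :=
  cintegrable [set: R] (fun t => f (sigma +i* t)).

Definition vline_integral (R : realType) (sigma : R) (f : R[i] -> R[i]) :
    R[i] :=
  'i%C * cintegral [set: R] (fun t => f (sigma +i* t)).

(* Euler's integral, for Re z > 0. *)
Definition cGamma (R : realType) (z : R[i]) : R[i] :=
  cintegral `]0, +oo[ (fun t => cpow t%:C (z - 1) * (expR (- t))%:C).

(* The alternating Hurwitz zeta function, for Re s > 0. The series is only
   conditionally convergent when Re s <= 1, hence the limit of partial sums. *)
Definition hurwitz_eta (R : realType) (s a : R[i]) : R[i] :=
  limn (series (fun k : nat => (-1) ^+ k / cpow (k%:R + a) s : R[i]^o)).

(* Main.v *)
Require Import Defs.
From mathcomp Require Import all_boot all_order all_algebra.
From mathcomp Require Import all_classical all_reals all_analysis.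
From mathcomp Require Import measurable_realfun ring lra.

Import Order.TTheory GRing.Theory Num.Theory.
Import numFieldNormedType.Exports.
Import Normc.

Set Implicit Arguments.
Unset Strict Implicit.
Unset Printing Implicit Defensive.

Local Open Scope classical_set_scope.
Local Open Scope ring_scope.
Local Open Scope complex_scope.

Local Notation Re := (@complex.Re _).
Local Notation Im := (@complex.Im _).

(* Termwise in the series of eta, the claim is the Mellin-Barnes formula: the
   integral of [a^(-v) Gamma(v) Gamma(s - v) c^(v - s)] over a vertical line is
   [2 pi i Gamma(s) (a + c)^(-s)]. Since [Gamma(v) Gamma(s - v) / Gamma(s)] is
   the integral of [e^(v u) (1 + e^u)^(-s)] over real u, moving the u-line to
   height arg a, which is allowed for |arg a| < pi, makes it a Fourier transform,
   and Fourier inversion gives the formula. Moving the line slightly further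
   yields exponential decay in Im v. As the partial sums of eta(s - v, c) grow at
   most linearly in |v|, dominated convergence then sums the series. *)

(** Complex functions of a real variable are handled as pairs of real functions. Cauchy's theorem on
    a strip becomes a differentiation in the height of the line: that derivative is ['i] times the
    integral of a total derivative, hence zero. The series of eta(s - v, c) may converge only
    conditionally, namely when Re (s - v) <= 1, so absolute summation cannot justify exchanging sum
    and integral. What works is one bound for all partial sums, |z| / Re z * c^(-Re z) with z = s -
    v, obtained by pairing consecutive terms; absorbing the factor |z| costs half of the exponential
    decay. On the line of integration eta only has the real parameter w + 1/2, so its powers raise
    no question of branch. The complex parameter enters through a + c = c (1 + a / c) with c > 0, a
    factorization that principal powers respect. Dividing by Gamma(b + 1) requires Gamma to have no
    zero of positive real part. This is proved first far to the right, by a direct estimate of the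
    integral, and then pulled back with the functional equation. *)

(** * Modulus, exponential and principal logarithm in real coordinates *)

Section ComplexBasics.
Variable R : realType.
Implicit Types (z w : R[i]) (x y t : R).

Lemma cReD z w : Re (z + w) = Re z + Re w. Proof. by case: z w => [? ?] [? ?]. Qed.
Lemma cImD z w : Im (z + w) = Im z + Im w. Proof. by case: z w => [? ?] [? ?]. Qed.
Lemma cReN z : Re (- z) = - Re z. Proof. by case: z. Qed.
Lemma cImN z : Im (- z) = - Im z. Proof. by case: z. Qed.
Lemma cReM z w : Re (z * w) = Re z * Re w - Im z * Im w.
Proof. by case: z w => [? ?] [? ?]. Qed.
Lemma cImM z w : Im (z * w) = Re z * Im w + Im z * Re w.
Proof. by case: z w => [? ?] [? ?]. Qed.

Lemma ReI z w : Re z = Re w -> Im z = Im w -> z = w.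
Proof. by case: z w => [? ?] [? ?] /= -> ->. Qed.

Lemma normc_sqrt z : normc z = Num.sqrt (Re z ^+ 2 + Im z ^+ 2).
Proof. by case: z. Qed.

Lemma normc_sqr z : normc z ^+ 2 = Re z ^+ 2 + Im z ^+ 2.
Proof. by rewrite normc_sqrt sqr_sqrtr// addr_ge0 ?sqr_ge0. Qed.

Lemma normc_ge0 z : 0 <= normc z. Proof. by rewrite normc_sqrt sqrtr_ge0. Qed.

Lemma normc_gt0 z : (0 < normc z) = (z != 0).
Proof.
rewrite lt_def normc_ge0 andbT; congr (~~ _); apply/eqP/eqP => [/eq0_normc//|->].
exact: normc0.
Qed.

Lemma le_Re_normc z : `|Re z| <= normc z.
Proof. by rewrite normc_sqrt -sqrtr_sqr ler_wsqrtr// lerDl sqr_ge0. Qed.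

Lemma le_Im_normc z : `|Im z| <= normc z.
Proof. by rewrite normc_sqrt -sqrtr_sqr ler_wsqrtr// lerDr sqr_ge0. Qed.

Lemma normc_real x : normc x%:C = `|x|.
Proof. by rewrite normc_sqrt /= expr0n addr0 sqrtr_sqr. Qed.

Lemma normcD z w : normc (z + w) <= normc z + normc w.
Proof. exact: le_normcD. Qed.

Lemma le_normc_Re_Im z : normc z <= `|Re z| + `|Im z|.
Proof.
rewrite -(@ler_pXn2r _ 2) ?nnegrE ?addr_ge0 ?normc_ge0//.
rewrite normc_sqr sqrrD !real_normK ?num_real//.
have := mulr_ge0 (normr_ge0 (Re z)) (normr_ge0 (Im z)); lra.
Qed.

Lemma cexpD z w : cexp (z + w) = cexp z * cexp w.
Proof.
case: z w => [x y] [x' y']; rewrite /cexp/= expRD cosD sinD.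
by apply: ReI => /=; ring.
Qed.

Lemma cexp_real x : cexp x%:C = (expR x)%:C.
Proof. by rewrite /cexp/= cos0 sin0; apply: ReI => /=; ring. Qed.

Lemma cexp0 : cexp 0 = 1 :> R[i].
Proof. by rewrite -[0]/(0%:C) cexp_real expR0. Qed.

Lemma Re_cexp z : Re (cexp z) = expR (Re z) * cos (Im z).
Proof. by case: z => x y /=; ring. Qed.

Lemma Im_cexp z : Im (cexp z) = expR (Re z) * sin (Im z).
Proof. by case: z => x y /=; ring. Qed.

Lemma normc_cexp z : normc (cexp z) = expR (Re z).
Proof.
rewrite normc_sqrt Re_cexp Im_cexp !exprMn -mulrDr cos2Dsin2 mulr1.
by rewrite sqrtr_sqr ger0_norm// expR_ge0.
Qed.

Lemma cexp_neq0 z : cexp z != 0.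
Proof. by rewrite -normc_gt0 normc_cexp expR_gt0. Qed.

Lemma cexpN z : cexp (- z) = (cexp z)^-1.
Proof.
by apply: (mulfI (cexp_neq0 z)); rewrite -cexpD subrr cexp0 mulfV// cexp_neq0.
Qed.

Definition slit_plane : set R[i] := [set z | 0 < Re z \/ Im z != 0].

Lemma slit_neq0 z : slit_plane z -> z != 0.
Proof. by case=> [|]; apply: contraTneq => ->; rewrite ?ltxx ?eqxx. Qed.

Lemma slit_gt0 z : slit_plane z -> 0 < Re z + normc z.
Proof.
move=> sz; have z0 : 0 < normc z by rewrite normc_gt0 slit_neq0.
case: sz => [rz|iz]; first exact: addr_gt0.
rewrite -ltrBlDl sub0r (le_lt_trans (ler_norm _))// normrN.
rewrite normc_sqrt -sqrtr_sqr ltr_sqrt; last by rewrite ltr_wpDl ?sqr_ge0// exprn_even_gt0.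
by rewrite ltrDl exprn_even_gt0.
Qed.

Lemma cos_2atan x : cos (2 * atan x) = (1 - x ^+ 2) / (1 + x ^+ 2).
Proof.
have h : 1 + x ^+ 2 != 0 by rewrite gt_eqF// ltr_pwDl// sqr_ge0.
rewrite mulr_natl cos_mulr2n cos_atan exprVn sqr_sqrtr ?addr_ge0 ?sqr_ge0//.
by rewrite mulr2n; field.
Qed.

Lemma cos_carg_bounds z : z != 0 -> -1 <= Re z / normc z <= 1.
Proof.
rewrite -normc_gt0 => z0; rewrite -ler_norml normf_div (ger0_norm (ltW z0)).
by rewrite ler_pdivrMr// mul1r le_Re_normc.
Qed.

Lemma cargE z : carg z = (if 0 <= Im z then acos (Re z / normc z)
                          else - acos (Re z / normc z)).
Proof. by case: z. Qed.

(** Half-angle formula tan (arg z / 2) = Im z / (Re z + |z|). Unlike the [acos] form, it has no case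
    split and stays differentiable across the positive real axis. *)
Lemma carg_atan z : slit_plane z ->
  carg z = 2 * atan (Im z / (Re z + normc z)).
Proof.
move=> sz; have d0 := slit_gt0 sz.
have z0 : 0 < normc z by rewrite normc_gt0 slit_neq0.
set r := normc z in d0 z0 *.
have cosE : cos (2 * atan (Im z / (Re z + r))) = Re z / r.
  have h : r ^+ 2 = Re z ^+ 2 + Im z ^+ 2 by rewrite /r normc_sqr.
  have h2 : Im z ^+ 2 = r ^+ 2 - Re z ^+ 2 by rewrite h; ring.
  rewrite cos_2atan expr_div_n h2.
  field; rewrite gt_eqF//= gt_eqF//=.
  have -> : (Re z + r) ^+ 2 + (r ^+ 2 - Re z ^+ 2) = 2 * (r * (Re z + r)) by ring.
  by rewrite gt_eqF// mulr_gt0// mulr_gt0.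
have at_lt := atan_ltpi2 (Im z / (Re z + r)).
have at_gt := atan_gtNpi2 (Im z / (Re z + r)).
rewrite cargE -/r -cosE; case: ifPn => iz.
  rewrite cosK// in_itv/=; apply/andP; split; last by lra.
  by rewrite mulr_ge0// -(atan0 R) le_atan// divr_ge0// ltW.
rewrite -ltNge in iz.
rewrite cosKN ?opprK//; apply/andP; split; first by lra.
rewrite pmulr_rle0//.
by rewrite -(atan0 R) le_atan// pmulr_lle0 ?invr_gt0 ?ltW.
Qed.

Lemma clogE z : clog z = ln (normc z) +i* carg z.
Proof. by case: z. Qed.

Lemma clogK z : z != 0 -> cexp (clog z) = z.
Proof.
move=> z0; have b := cos_carg_bounds z0; have n0 : 0 < normc z by rewrite normc_gt0.
rewrite clogE; apply: ReI; rewrite ?Re_cexp ?Im_cexp /= lnK// cargE.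
  have -> : cos (if 0 <= Im z then acos (Re z / normc z)
                  else - acos (Re z / normc z)) = Re z / normc z.
    by case: ifP => _; rewrite ?cosN acosK// in_itv.
  by rewrite mulrC divfK// gt_eqF.
have sE : sin (acos (Re z / normc z)) = `|Im z| / normc z.
  rewrite sin_acos//.
  have -> : 1 - (Re z / normc z) ^+ 2 = (Im z / normc z) ^+ 2.
    rewrite !expr_div_n.
    have -> : Im z ^+ 2 = normc z ^+ 2 - Re z ^+ 2 by rewrite normc_sqr; ring.
    by field; rewrite gt_eqF.
  by rewrite sqrtr_sqr normf_div (gtr0_norm n0).
have -> : sin (if 0 <= Im z then acos (Re z / normc z)
                  else - acos (Re z / normc z)) = Im z / normc z.
  case: ifPn => iz; rewrite ?sinN sE; first by rewrite ger0_norm.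
  by rewrite -ltNge in iz; rewrite ltr0_norm// mulNr opprK.
by rewrite mulrC divfK// gt_eqF.
Qed.

(** A positive factor leaves the argument unchanged, so no multiple of 2 pi i can appear, as it may
    for a general product. *)
Lemma clogMr x z : 0 < x -> z != 0 -> clog (x%:C * z) = (ln x)%:C + clog z.
Proof.
move=> x0 z0; have n0 : 0 < normc z by rewrite normc_gt0.
rewrite !clogE !cargE normcM normc_real (gtr0_norm x0).
have -> : Re (x%:C * z) = x * Re z by rewrite cReM /= mul0r subr0.
have -> : Im (x%:C * z) = x * Im z by rewrite cImM /= mul0r addr0.
rewrite pmulr_rge0// -mulf_div divff ?gt_eqF// mul1r lnM//.
by apply: ReI => /=; rewrite ?add0r.
Qed.

Lemma clog_real x : 0 < x -> clog x%:C = (ln x)%:C.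
Proof.
move=> x0; rewrite clogE cargE normc_real gtr0_norm//= lexx divff ?gt_eqF//.
by rewrite acos1.
Qed.

Lemma clog_slit_Im z : slit_plane z -> - pi < Im (clog z) < pi.
Proof.
move=> sz; rewrite clogE /= carg_atan//.
have := atan_ltpi2 (Im z / (Re z + normc z)).
by have := atan_gtNpi2 (Im z / (Re z + normc z)) => *; apply/andP; split; lra.
Qed.

End ComplexBasics.

Arguments cexp : simpl never.
Arguments carg : simpl never.
Arguments clog : simpl never.
Arguments Normc.normc : simpl never.

(** * Derivatives of complex functions along a real variable *)

Section ComplexDerivative.
Variable R : realType.
Implicit Types (f g : R -> R[i]) (x : R) (d e c : R[i]).

(** Analyticity is only ever used through such derivatives, taken along horizontal and vertical
    lines. *)
Definition is_cderive f x d :=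
  is_derive x 1 (fun t => Re (f t)) (Re d) /\
  is_derive x 1 (fun t => Im (f t)) (Im d).

Lemma is_cderive_eq f x d e : is_cderive f x d -> d = e -> is_cderive f x e.
Proof. by move=> ? <-. Qed.

Lemma is_cderive_unique f x d e : is_cderive f x d -> is_cderive f x e -> d = e.
Proof.
move=> [[_ h1] [_ h2]] [[_ h3] [_ h4]].
by apply: ReI; [rewrite -h1 -h3|rewrite -h2 -h4].
Qed.

Lemma is_cderive_cst c x : is_cderive (fun=> c) x 0.
Proof. by split; exact: is_derive_cst. Qed.

Lemma is_cderive_real x : is_cderive (fun t => t%:C) x 1.
Proof. by split; [exact: is_derive_id|exact: is_derive_cst]. Qed.

Lemma is_cderiveD f g x d e : is_cderive f x d -> is_cderive g x e ->
  is_cderive (fun t => f t + g t) x (d + e).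
Proof.
move=> [f1 f2] [g1 g2]; split; rewrite ?cReD ?cImD.
  by under eq_fun do rewrite cReD; exact: is_deriveD.
by under eq_fun do rewrite cImD; exact: is_deriveD.
Qed.

Lemma is_cderiveN f x d : is_cderive f x d -> is_cderive (fun t => - f t) x (- d).
Proof.
move=> [f1 f2]; split; rewrite ?cReN ?cImN.
  by under eq_fun do rewrite cReN; exact: is_deriveN.
by under eq_fun do rewrite cImN; exact: is_deriveN.
Qed.

Lemma is_cderiveM f g x d e : is_cderive f x d -> is_cderive g x e ->
  is_cderive (fun t => f t * g t) x (d * g x + f x * e).
Proof.
move=> [f1 f2] [g1 g2]; split.
  under eq_fun do rewrite cReM.
  by apply: is_derive_eq; rewrite cReD !cReM /GRing.scale /=; ring.
under eq_fun do rewrite cImM.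
by apply: is_derive_eq; rewrite cImD !cImM /GRing.scale /=; ring.
Qed.

Lemma is_cderive_cexp f x d : is_cderive f x d ->
  is_cderive (fun t => cexp (f t)) x (d * cexp (f x)).
Proof.
move=> [f1 f2]; split.
  under eq_fun do rewrite Re_cexp.
  by apply: is_derive_eq; rewrite cReM Re_cexp Im_cexp /GRing.scale /=; ring.
under eq_fun do rewrite Im_cexp.
by apply: is_derive_eq; rewrite cImM Re_cexp Im_cexp /GRing.scale /=; ring.
Qed.

Lemma is_derive_normc f x d : f x != 0 -> is_cderive f x d ->
  is_derive x 1 (fun t => normc (f t))
    ((Re (f x) * Re d + Im (f x) * Im d) / normc (f x)).
Proof.
rewrite -normc_gt0 => fx0 [f1 f2].
have h : 0 < Re (f x) ^+ 2 + Im (f x) ^+ 2 by rewrite -normc_sqr exprn_gt0.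
have {h}h := is_derive1_sqrt h.
under eq_fun do rewrite normc_sqrt.
apply: is_derive_eq; rewrite -normc_sqrt /GRing.scale /=; field.
by rewrite gt_eqF.
Qed.

Lemma is_cderive_continuous f x d : is_cderive f x d ->
  {for x, continuous (fun t => Re (f t))} /\
  {for x, continuous (fun t => Im (f t))}.
Proof.
by move=> [[h1 _] [h2 _]]; split;
  apply: differentiable_continuous; apply/derivable1_diffP.
Qed.

Lemma near_slit_plane f x d : is_cderive f x d -> slit_plane (f x) ->
  \forall t \near x, slit_plane (f t).
Proof.
move=> /is_cderive_continuous[c1 c2] [h|h].
  by near=> t; left; near: t; exact: (cvgr_gt _ c1).
by near=> t; right; near: t; exact: (cvgr_neq0 _ c2).
Unshelve. all: by end_near. Qed.

Lemma is_cderive_clog f x d : is_cderive f x d -> slit_plane (f x) ->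
  is_cderive (fun t => clog (f t)) x (d / f x).
Proof.
move=> fd sx; have fx0 := slit_neq0 sx.
have n0 : 0 < normc (f x) by rewrite normc_gt0.
have dn := is_derive_normc fx0 fd.
case: (fd) => f1 f2.
(* The inverse of [f x] is its conjugate divided by the square of its modulus. *)
have -> : d / f x = d * (Re (f x) / normc (f x) ^+ 2 +i* (- (Im (f x) / normc (f x) ^+ 2))).
  by congr (_ * _); rewrite normc_sqr; case: (f x) => u v.
split.
  have dl := is_derive1_ln n0.
  under eq_fun do rewrite clogE /=.
  by apply: is_derive_eq; rewrite cReM /=; field; rewrite gt_eqF.
have s0 := slit_gt0 sx.
have st := near_slit_plane fd sx.
(* The half-angle formula holds on the slit plane only; this is an open condition, so it holds near
   [x]. *)
apply: (@near_eq_is_derive _ _ _ (fun t => 2 * atan (Im (f t) / (Re (f t) + normc (f t))))).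
  by near=> t; rewrite clogE /= carg_atan//; near: t.
have sn : Re (f x) + normc (f x) != 0 by rewrite gt_eqF.
have dv := @is_deriveV _ (fun t => Re (f t) + normc (f t)) _ _ _ sn (is_deriveD f1 dn).
apply: is_derive_eq; rewrite cImM /GRing.scale /=.
have h : Im (f x) ^+ 2 = normc (f x) ^+ 2 - Re (f x) ^+ 2 by rewrite normc_sqr; ring.
set n := normc (f x) in n0 s0 sn h *.
have h1 : 1 + (Im (f x) / (Re (f x) + n)) ^+ 2 = 2 * n / (Re (f x) + n).
  by rewrite expr_div_n h; field.
rewrite h1.
have n1 : n != 0 by rewrite gt_eqF.
(* The final identity holds only modulo Im^2 = n^2 - Re^2, a relation that [field] cannot use by
   itself; the one monomial concerned is isolated and replaced. *)
have h2 : Im (f x) * (Im (f x) * Im d) = (n ^+ 2 - Re (f x) ^+ 2) * Im d.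
  by rewrite -h; ring.
transitivity (((Im d * (Re (f x) + n) - Im (f x) * Re d) * n
    - Im (f x) * Re (f x) * Re d - Im (f x) * (Im (f x) * Im d))
  / (n ^+ 2 * (Re (f x) + n))).
  by field; rewrite sn.
by rewrite h2; field; rewrite ?n1 ?sn.
Unshelve. all: by end_near. Qed.

End ComplexDerivative.

(** * Measurability and integration of complex functions, component by component *)

Section ComplexMeasurable.
Variables (R : realType) (d : measure_display) (T : measurableType d).
Implicit Types (f g : T -> R[i]) (u : T -> R).

Definition cmeasurable f :=
  measurable_fun [set: T] (fun x => Re (f x)) /\
  measurable_fun [set: T] (fun x => Im (f x)).

Lemma cmeasurable_cst c : cmeasurable (fun=> c).
Proof. by split; exact: measurable_cst. Qed.

Lemma cmeasurable_real u : measurable_fun setT u -> cmeasurable (fun x => (u x)%:C).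
Proof. by split => //; exact: measurable_cst. Qed.

Lemma cmeasurableD f g : cmeasurable f -> cmeasurable g ->
  cmeasurable (fun x => f x + g x).
Proof.
move=> [f1 f2] [g1 g2]; split.
  by under eq_fun do rewrite cReD; exact: measurable_funD.
by under eq_fun do rewrite cImD; exact: measurable_funD.
Qed.

Lemma cmeasurableN f : cmeasurable f -> cmeasurable (fun x => - f x).
Proof.
move=> [f1 f2]; split.
  by under eq_fun do rewrite cReN; exact: measurableT_comp.
by under eq_fun do rewrite cImN; exact: measurableT_comp.
Qed.

Lemma cmeasurableM f g : cmeasurable f -> cmeasurable g ->
  cmeasurable (fun x => f x * g x).
Proof.
move=> [f1 f2] [g1 g2]; split.
  by under eq_fun do rewrite cReM; apply: measurable_funB; exact: measurable_funM.
by under eq_fun do rewrite cImM; apply: measurable_funD; exact: measurable_funM.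
Qed.

Lemma cmeasurable_cexp f : cmeasurable f -> cmeasurable (fun x => cexp (f x)).
Proof.
move=> [f1 f2]; split.
  under eq_fun do rewrite Re_cexp; apply: measurable_funM.
    by apply: measurableT_comp => //; exact: measurable_expR.
  by apply: measurableT_comp => //; apply: continuous_measurable_fun; exact: continuous_cos.
under eq_fun do rewrite Im_cexp; apply: measurable_funM.
  by apply: measurableT_comp => //; exact: measurable_expR.
by apply: measurableT_comp => //; apply: continuous_measurable_fun; exact: continuous_sin.
Qed.

Lemma measurable_normc f : cmeasurable f -> measurable_fun setT (fun x => normc (f x)).
Proof.
move=> [f1 f2]; under eq_fun do rewrite normc_sqrt.
have ms : measurable_fun setT (@Num.sqrt R).
  by apply: continuous_measurable_fun; exact: sqrt_continuous.
have mh : measurable_fun setT (fun x => Re (f x) ^+ 2 + Im (f x) ^+ 2).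
  by apply: measurable_funD; exact: measurable_funX.
exact: (measurableT_comp ms mh).
Qed.

Lemma cmeasurable_cvg (f_ : nat -> T -> R[i]) f :
  (forall n, cmeasurable (f_ n)) ->
  (forall x, Re (f_ n x) @[n --> \oo] --> Re (f x) /\ Im (f_ n x) @[n --> \oo] --> Im (f x)) ->
  cmeasurable f.
Proof.
move=> mf cf; split.
  by apply: (measurable_fun_cvg (fun n => (mf n).1)) => x _; exact: (cf x).1.
by apply: (measurable_fun_cvg (fun n => (mf n).2)) => x _; exact: (cf x).2.
Qed.

End ComplexMeasurable.

Lemma cmeasurable_comp (R : realType) d d' (T : measurableType d) (T' : measurableType d')
    (f : T' -> R[i]) (g : T -> T') :
  cmeasurable f -> measurable_fun setT g -> cmeasurable (fun x => f (g x)).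
Proof.
move=> [f1 f2] mg.
by split; [exact: (measurableT_comp f1 mg)|exact: (measurableT_comp f2 mg)].
Qed.

(** Componentwise, to match the componentwise integral; [ccvg_lim] links it to the limit used in
    [hurwitz_eta]. *)
Definition ccvg (R : realType) (u : nat -> R[i]) (l : R[i]) : Prop :=
  Re (u n) @[n --> \oo] --> Re l /\ Im (u n) @[n --> \oo] --> Im l.

Section ComplexIntegral.
Variable R : realType.
Notation mu := (@lebesgue_measure R).
Implicit Types (f g : R -> R[i]) (h : R -> R) (c : R[i]).

Lemma is_cderive_measurable f (df : R -> R[i]) :
  (forall x, is_cderive f x (df x)) -> cmeasurable f.
Proof.
move=> fd; split; apply: continuous_measurable_fun => x.
  by case: (is_cderive_continuous (fd x)).
by case: (is_cderive_continuous (fd x)).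
Qed.

Lemma cintegrable_measurable f : cintegrable setT f -> cmeasurable f.
Proof.
by move=> [/measurable_int/measurable_EFinP f1 /measurable_int/measurable_EFinP f2].
Qed.

Lemma le_cintegrable f h : cmeasurable f -> (forall x, normc (f x) <= h x) ->
  mu.-integrable setT (EFin \o h) -> cintegrable setT f.
Proof.
move=> [f1 f2] fh ih; split; apply: le_integrable ih => //; first exact/measurable_EFinP.
- move=> x _ /=; rewrite lee_fin (le_trans (le_Re_normc _))// (le_trans (fh x))//.
  exact: ler_norm.
- exact/measurable_EFinP.
- move=> x _ /=; rewrite lee_fin (le_trans (le_Im_normc _))// (le_trans (fh x))//.
  exact: ler_norm.
Qed.

Lemma integrable_normc f : cintegrable setT f ->
  mu.-integrable setT (EFin \o (fun x => normc (f x))).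
Proof.
move=> cf; have mf := cintegrable_measurable cf; case: (cf) => f1 f2.
have i := integrableD measurableT (integrable_abse f1) (integrable_abse f2).
apply: le_integrable i => //.
  by apply/measurable_EFinP; exact: measurable_normc.
move=> x _ /=; rewrite lee_fin ger0_norm ?normc_ge0// ger0_norm ?addr_ge0//.
exact: le_normc_Re_Im.
Qed.

Lemma eq_cintegral f g : f =1 g -> cintegral setT f = cintegral setT g.
Proof. by move=> /funext->. Qed.

Lemma cintegrableD f g : cintegrable setT f -> cintegrable setT g ->
  cintegrable setT (fun x => f x + g x).
Proof.
move=> [f1 f2] [g1 g2]; split.
  by under eq_fun do rewrite cReD EFinD; exact: integrableD.
by under eq_fun do rewrite cImD EFinD; exact: integrableD.
Qed.

Lemma cintegralD f g : cintegrable setT f -> cintegrable setT g ->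
  cintegral setT (fun x => f x + g x) = cintegral setT f + cintegral setT g.
Proof.
move=> [f1 f2] [g1 g2]; rewrite /cintegral.
under eq_Rintegral do rewrite cReD.
under [X in _ +i* X]eq_Rintegral do rewrite cImD.
by rewrite !RintegralD.
Qed.

Lemma cintegrableZl c f : cintegrable setT f -> cintegrable setT (fun x => c * f x).
Proof.
move=> [f1 f2]; split.
  under eq_fun do rewrite cReM EFinB !EFinM.
  by apply: integrableB => //; exact: integrableZl.
under eq_fun do rewrite cImM EFinD !EFinM.
by apply: integrableD => //; exact: integrableZl.
Qed.

Lemma cintegralZl c f : cintegrable setT f ->
  cintegral setT (fun x => c * f x) = c * cintegral setT f.
Proof.
move=> [f1 f2]; rewrite /cintegral.
have h (k : R) h : mu.-integrable setT (EFin \o h) ->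
    mu.-integrable setT (EFin \o (fun x => k * h x)).
  by move=> ih; rewrite /comp; under eq_fun do rewrite EFinM; exact: integrableZl.
under eq_Rintegral do rewrite cReM.
under [X in _ +i* X]eq_Rintegral do rewrite cImM.
rewrite RintegralB//; [|exact: h..].
rewrite RintegralD//; [|exact: h..].
by rewrite !RintegralZl//; case: c => a b.
Qed.

Lemma cintegral0 : cintegral setT (fun=> 0) = 0 :> R[i].
Proof.
rewrite /cintegral /=; apply: ReI => /=; rewrite /Rintegral integral_cst//= ?mul0e//.
Qed.

Lemma cintegrable0 : cintegrable setT (fun=> 0 : R[i]).
Proof. by split => /=; exact: integrable0. Qed.

(** The factor 2 comes from bounding the real and the imaginary part separately. *)
Lemma le_normc_cintegral f : cintegrable setT f ->
  normc (cintegral setT f) <= 2 * \int[mu]_x normc (f x).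
Proof.
move=> cf; have nf := integrable_normc cf; case: (cf) => f1 f2.
apply: le_trans (le_normc_Re_Im _) _; rewrite mulr_natl mulr2n /=.
have key (p : R -> R) : mu.-integrable setT (EFin \o p) ->
    (forall x, `|p x| <= normc (f x)) -> `|\int[mu]_x p x| <= \int[mu]_x normc (f x).
  move=> ip pf; apply: le_trans (le_normr_Rintegral _ _) _ => //.
  by apply: le_Rintegral => //; exact: (integrable_abse ip).
by apply: lerD; apply: key => // x; rewrite ?le_Re_normc ?le_Im_normc.
Qed.

Lemma cdominated_convergence (f_ : nat -> R -> R[i]) f h :
  (forall n, cmeasurable (f_ n)) -> (forall x, ccvg (f_ ^~ x) (f x)) ->
  mu.-integrable setT (EFin \o h) -> (forall n x, normc (f_ n x) <= h x) ->
  cintegrable setT f /\ ccvg (fun n => cintegral setT (f_ n)) (cintegral setT f).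
Proof.
move=> mf_ cf ih fh; have mf := cmeasurable_cvg mf_ cf.
have key (p_ : nat -> R -> R) (p : R -> R) : (forall n, measurable_fun setT (p_ n)) ->
  measurable_fun setT p -> (forall x, p_ n x @[n --> \oo] --> p x) ->
  (forall n x, `|p_ n x| <= h x) -> mu.-integrable setT (EFin \o p) /\
  \int[mu]_x (p_ n x) @[n --> \oo] --> \int[mu]_x (p x).
  move=> mp_ mp cp hp.
  have [] := @dominated_convergence _ _ _ mu _ measurableT
    (fun n => EFin \o p_ n) (EFin \o p) (EFin \o h).
  - by move=> n; apply/measurable_EFinP; exact: mp_.
  - by apply/measurable_EFinP; exact: mp.
  - by apply: aeW => x _; apply: cvg_EFin; [exact: nearW|exact: cp].
  - exact: ih.
  - by apply: aeW => x n _; rewrite lee_fin hp.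
  move=> i1 _ i2; split => //.
  apply: fine_cvg; rewrite /Rintegral fineK//.
  exact: integrable_fin_num.
have [i1 l1] := key (fun n x => Re (f_ n x)) (fun x => Re (f x)) (fun n => (mf_ n).1) mf.1
  (fun x => (cf x).1) (fun n x => le_trans (le_Re_normc _) (fh n x)).
have [i2 l2] := key (fun n x => Im (f_ n x)) (fun x => Im (f x)) (fun n => (mf_ n).2) mf.2
  (fun x => (cf x).2) (fun n x => le_trans (le_Im_normc _) (fh n x)).
by split; split.
Qed.

End ComplexIntegral.

(** * Exchange of two complex integrals *)

Section Fubini.
Variable R : realType.
Notation mu := (@lebesgue_measure R).
Implicit Types (f : R * R -> R[i]).

Lemma cfubini f : cmeasurable f ->
  (forall x, cintegrable setT (fun y => f (x, y))) ->
  (forall y, cintegrable setT (fun x => f (x, y))) ->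
  (\int[mu]_x \int[mu]_y (normc (f (x, y)))%:E < +oo)%E ->
  cintegral setT (fun x => cintegral setT (fun y => f (x, y))) =
  cintegral setT (fun y => cintegral setT (fun x => f (x, y))).
Proof.
move=> mf f1 f2 intf.
have key (p : R * R -> R) : measurable_fun setT p ->
    (forall x, mu.-integrable setT (fun y => (p (x, y))%:E)) ->
    (forall y, mu.-integrable setT (fun x => (p (x, y))%:E)) ->
    (forall z, `|p z| <= normc (f z)) ->
    \int[mu]_x \int[mu]_y p (x, y) = \int[mu]_y \int[mu]_x p (x, y).
  move=> mp p1 p2 pf.
  have mpE : measurable_fun setT (EFin \o p) by apply/measurable_EFinP; exact: mp.
  have ip : (mu \x mu)%E.-integrable setT (EFin \o p).
    apply/integrable12ltyP; first exact: mpE.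
    apply: le_lt_trans intf; apply: ge0_le_integral => //.
    - by move=> x _; apply: integral_ge0 => y _; exact: abse_ge0.
    - apply: (@measurable_fun_fubini_tonelli_F _ _ _ _ _ mu (abse \o (EFin \o p)));
        [exact: (measurableT_comp _ mpE)|by move=> z; rewrite /= lee_fin normr_ge0].
    - apply: (@measurable_fun_fubini_tonelli_F _ _ _ _ _ mu (EFin \o (fun z => normc (f z)))).
      + by apply/measurable_EFinP; exact: measurable_normc.
      + by move=> z; rewrite lee_fin normc_ge0.
    - move=> x _; apply: ge0_le_integral => //.
      + by apply: measurableT_comp => //; exact: (measurable_int _ (p1 x)).
      + apply/measurable_EFinP; apply: measurable_normc.
        exact: cintegrable_measurable (f1 x).
      + by move=> y _; rewrite lee_fin pf.
  rewrite /Rintegral; congr fine.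
  (* Every section is integrable, so the inner integrals are finite and [fine] can be removed before
     Fubini's theorem is applied. *)
  have e1 x : ((fine (\int[mu]_y (p (x, y))%:E))%:E = \int[mu]_y (p (x, y))%:E)%E.
    by rewrite fineK//; exact: integrable_fin_num.
  have e2 y : ((fine (\int[mu]_x (p (x, y))%:E))%:E = \int[mu]_x (p (x, y))%:E)%E.
    by rewrite fineK//; exact: integrable_fin_num.
  under eq_integral do rewrite e1.
  under [RHS]eq_integral do rewrite e2.
  exact: (Fubini ip).
apply: ReI => /=.
  apply: (key (fun z => Re (f z))) => [|x|y|z].
  - exact: mf.1.
  - exact: (f1 x).1.
  - exact: (f2 y).1.
  - exact: le_Re_normc.
apply: (key (fun z => Im (f z))) => [|x|y|z].
- exact: mf.2.
- exact: (f1 x).2.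
- exact: (f2 y).2.
- exact: le_Im_normc.
Qed.

End Fubini.

(** * Affine changes of variable on the line *)

Section Affine.
Variable R : realType.
Notation mu := (@lebesgue_measure R).
Implicit Types (c d : R).

(** Uniqueness of Lebesgue measure: the rescaled pushforward agrees with it on half-open
    intervals. *)
Lemma lebesgue_measure_affine c d (A : set R) : 0 < c -> measurable A ->
  mu A = (c%:E * mu ((fun x => c * x + d)%R @^-1` A))%E.
Proof.
move=> c0 mA; pose phi : measurableTypeR R -> measurableTypeR R := fun x => c * x + d.
have mphi : measurable_fun setT phi.
  by apply: measurable_funD => //; exact: measurable_funM.
pose c' : {nonneg R} := NngNum (ltW c0).
rewrite (@lebesgue_measure_unique R (mscale c' (pushforward mu phi : {measure set _ -> \bar R})))//.
move=> _ [[a b] _ <-].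
change (mu `]a, b]%classic = (c%:E * mu (phi @^-1` `]a, b]%classic))%E).
have -> : phi @^-1` `]a, b]%classic = `](a - d) / c, (b - d) / c]%classic.
  apply/seteqP; split => x /=; rewrite !in_itv/=;
    by rewrite ltr_pdivrMr// ler_pdivlMr// lerBrDr ltrBlDr /phi mulrC.
rewrite !lebesgue_measure_itv/= !lte_fin ltr_pM2r ?invr_gt0// ltrD2r.
case: ifPn => ab; last by rewrite mule0.
rewrite -!EFinB -EFinM; congr EFin; field; lra.
Qed.

Lemma ge0_integral_affine c d (f : R -> \bar R) : 0 < c ->
  measurable_fun setT f -> (forall x, 0 <= f x)%E ->
  (\int[mu]_x f x = c%:E * \int[mu]_x f (c * x + d)%R)%E.
Proof.
move=> c0 mf f0; pose phi : measurableTypeR R -> measurableTypeR R := fun x => c * x + d.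
have mphi : measurable_fun setT phi.
  by apply: measurable_funD => //; exact: measurable_funM.
pose c' : {nonneg R} := NngNum (ltW c0).
rewrite (eq_measure_integral (mscale c' (pushforward mu phi))); last first.
  by move=> A mA _; exact: lebesgue_measure_affine.
by rewrite ge0_integral_mscale// ge0_integral_pushforward.
Qed.

Lemma integrable_affine c d (f : R -> \bar R) : 0 < c ->
  mu.-integrable setT f -> mu.-integrable setT (fun x => f (c * x + d)).
Proof.
move=> c0 /integrableP[mf intf]; apply/integrableP; split.
  apply: (measurableT_comp mf).
  by apply: measurable_funD => //; exact: measurable_funM.
move: intf; rewrite (ge0_integral_affine d c0)//; last exact: measurableT_comp.
by rewrite !ltey; apply: contraNN => /eqP ->; rewrite gt0_muley ?lte_fin.
Qed.

Lemma integral_affine c d (f : R -> \bar R) : 0 < c ->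
  mu.-integrable setT f ->
  (\int[mu]_x f x = c%:E * \int[mu]_x f (c * x + d)%R)%E.
Proof.
move=> c0 intf; have mf := measurable_int _ intf.
pose g x := c * x + d.
have intg : mu.-integrable setT (f \o g) := integrable_affine d c0 intf.
have eP : (\int[mu]_x f^\+ x = c%:E * \int[mu]_x (f \o g)^\+ x)%E.
  rewrite (funepos_comp f g); apply: (ge0_integral_affine d c0 (f := (f^\+)%E)) => //.
  exact: measurable_funepos.
have eN : (\int[mu]_x f^\- x = c%:E * \int[mu]_x (f \o g)^\- x)%E.
  rewrite (funeneg_comp f g); apply: (ge0_integral_affine d c0 (f := (f^\-)%E)) => //.
  exact: measurable_funeneg.
rewrite integralE eP eN -muleBr//; first by rewrite -integralE.
rewrite fin_num_adde_defr//.
exact: (integrable_fin_num measurableT (integrable_funepos measurableT intg)).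
Qed.

Lemma cintegrable_affine c d (f : R -> R[i]) : 0 < c -> cintegrable setT f ->
  cintegrable setT (fun x => f (c * x + d)).
Proof.
move=> c0 [f1 f2].
by split; [exact: (integrable_affine _ c0 f1)|exact: (integrable_affine _ c0 f2)].
Qed.

Lemma cintegral_affine c d (f : R -> R[i]) : 0 < c -> cintegrable setT f ->
  cintegral setT f = c%:C * cintegral setT (fun x => f (c * x + d)).
Proof.
move=> c0 [f1 f2].
have key (p : R -> R) : mu.-integrable setT (EFin \o p) ->
    \int[mu]_x p x = c * \int[mu]_x p (c * x + d).
  move=> ip; rewrite /Rintegral (integral_affine d c0 ip) fineM//.
  exact: integrable_fin_num (integrable_affine d c0 ip).
by apply: ReI; rewrite /= ?(key (fun x => Re (f x)) f1) ?(key (fun x => Im (f x)) f2); ring.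
Qed.

Lemma cintegral_shift d (f : R -> R[i]) : cintegrable setT f ->
  cintegral setT (fun x => f (x + d)) = cintegral setT f.
Proof.
move=> mf; rewrite [RHS](cintegral_affine d ltr01 mf) mul1r.
by apply: eq_cintegral => x; rewrite mul1r.
Qed.

End Affine.

Section ExpAbs.
Variable R : realType.
Notation mu := (@lebesgue_measure R).

(** By evenness it suffices to integrate over the half-line, where the function is [k^-1] times the
    exponential density. *)
Lemma integrable_expR_abs (k : R) : 0 < k ->
  mu.-integrable setT (EFin \o (fun x => expR (- (k * `|x|)))).
Proof.
move=> k0.
have h1 : mu.-integrable setT (EFin \o exponential_pdf k) by exact: integrable_exponential_pdf.
have cf : continuous (fun x : R => expR (- (k * `|x|))).
  move=> x; apply: continuous_comp; last exact: continuous_expR.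
  by apply: continuousN; apply: continuousM; [exact: cst_continuous|exact: norm_continuous].
have mf : measurable_fun setT (fun x : R => expR (- (k * `|x|))).
  exact: continuous_measurable_fun.
apply/integrableP; split; first by apply/measurable_EFinP; exact: mf.
under eq_integral do rewrite /= ger0_norm ?expR_ge0//.
rewrite ge0_symfun_integralT; [|by move=> x; exact: expR_ge0|by []|by move=> x /=; rewrite normrN].
have -> : [set x : R | 0 <= x] = `[0, +oo[%classic.
  by apply/seteqP; split => x /=; rewrite in_itv/= andbT.
rewrite (_ : \int[mu]_(x in _) _ =
  \int[mu]_(x in `[0%R, +oo[) ((k^-1)%:E * (exponential_pdf k x)%:E))%E; last first.
  apply: eq_integral => x; rewrite inE /= in_itv/= andbT => x0.
  by rewrite exponential_pdfE// -EFinM mulKf ?gt_eqF// ger0_norm// mulNr.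
have h2 : mu.-integrable `[0%R, +oo[ (fun x => (k^-1)%:E * (exponential_pdf k x)%:E)%E.
  by apply: integrableZl => //; apply: integrableS h1.
by rewrite -(fineK (integrable_fin_num _ h2))// -EFinM ltry.
Qed.

End ExpAbs.

(** * Differentiation under the integral and shift of the line of integration *)

Section DifferentiationUnderIntegral.
Variable R : realType.
Notation mu := (@lebesgue_measure R).

Lemma is_cderive_comp (f : R -> R[i]) (g : R -> R) x d e :
  is_cderive f (g x) d -> is_derive x 1 g e ->
  is_cderive (fun t => f (g t)) x (e%:C * d).
Proof.
move=> [f1 f2] g1; split.
  apply: is_derive_eq.
    exact: (@is_derive1_comp _ (fun t => Re (f t)) g).
  by rewrite cReM /=; ring.
apply: is_derive_eq.
  exact: (@is_derive1_comp _ (fun t => Im (f t)) g).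
by rewrite cImM /=; ring.
Qed.

Lemma is_cderive_integral (f df : R -> R -> R[i]) (a u v : R) (h : R -> R) :
  u < a < v ->
  (forall x, u < x < v -> cintegrable setT (f x)) ->
  (forall x y, u < x < v -> is_cderive (f ^~ y) x (df x y)) ->
  mu.-integrable setT (EFin \o h) ->
  (forall x y, u < x < v -> normc (df x y) <= h y) ->
  is_cderive (fun x => cintegral setT (f x)) a (cintegral setT (df a)).
Proof.
move=> uav intf derf inth ubf.
have h0 y : 0 <= h y by apply: le_trans (normc_ge0 _) (ubf a y uav).
have key (p dp : R -> R -> R) :
    (forall x, u < x < v -> mu.-integrable setT (EFin \o p x)) ->
    (forall x y, u < x < v -> is_derive x 1 (p ^~ y) (dp x y)) ->
    (forall x y, u < x < v -> `|dp x y| <= h y) ->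
    is_derive a 1 (fun x => \int[mu]_y p x y) (\int[mu]_y dp a y).
  move=> intp derp ubp.
  have Ia : `]u, v[%classic a by rewrite /= in_itv.
  have ip x : `]u, v[%classic x -> mu.-integrable setT (EFin \o p x).
    by rewrite /= in_itv/=; exact: intp.
  have dp1 x y : `]u, v[%classic x -> setT y -> derivable (p ^~ y) x 1.
    by rewrite /= in_itv/= => xuv _; have [] := derp x y xuv.
  have dpE x y : u < x < v -> derive1 (p ^~ y) x = dp x y.
    by move=> xuv; rewrite derive1E; have [] := derp x y xuv.
  have ub x y : `]u, v[%classic x -> setT y -> `|derive1 (p ^~ y) x| <= h y.
    by rewrite /= in_itv/= => xuv _; rewrite dpE//; exact: ubp.
  have d1 := derivable_under_integral measurableT Ia ip dp1 h0 inth ub.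
  have d2 := differentiation_under_integral measurableT Ia ip dp1 h0 inth ub.
  apply: DeriveDef => //; rewrite -derive1E d2.
  by apply: eq_Rintegral => y _; exact: dpE.
split; rewrite /cintegral /=.
- apply: (key (fun x y => Re (f x y)) (fun x y => Re (df x y))).
  + by move=> x /intf[].
  + by move=> x y /derf-/(_ y)[].
  + by move=> x y xuv; apply: le_trans (le_Re_normc _) (ubf _ _ xuv).
- apply: (key (fun x y => Im (f x y)) (fun x y => Im (df x y))).
  + by move=> x /intf[].
  + by move=> x y /derf-/(_ y)[].
  + by move=> x y xuv; apply: le_trans (le_Im_normc _) (ubf _ _ xuv).
Qed.

Lemma is_cderive0_cst (f : R -> R[i]) (u v p q : R) :
  (forall x, u < x < v -> is_cderive f x 0) -> u < p < v -> u < q < v -> f p = f q.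
Proof.
move=> df.
have key (g : R -> R) : (forall x, u < x < v -> is_derive x 1 g 0) ->
    forall x y, u < x -> y < v -> x < y -> g x = g y.
  move=> dg x y ux yv xy.
  have dg' z : z \in `]x, y[ -> is_derive z 1 g 0.
    by rewrite in_itv/= => /andP[xz zy]; apply: dg; lra.
  have cg : {within `[x, y], continuous g}.
    apply: derivable_within_continuous => z; rewrite in_itv/= => /andP[xz zy].
    by apply: (@ex_derive _ _ _ _ _ _ _ (dg z _)); lra.
  by have [c _] := MVT xy dg' cg; rewrite mul0r => /eqP; rewrite subr_eq0 => /eqP.
move=> /andP[up pv] /andP[uq qv].
have dR x : u < x < v -> is_derive x 1 (fun t => Re (f t)) 0 by move=> /df[].
have dI x : u < x < v -> is_derive x 1 (fun t => Im (f t)) 0 by move=> /df[].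
have [pq|qp|->//] := ltgtP p q.
  by apply: ReI; [apply: (key _ dR)|apply: (key _ dI)].
by apply: ReI; apply/esym; [apply: (key _ dR)|apply: (key _ dI)].
Qed.

Lemma integrable_cst_expR_abs (C k : R) : 0 < k ->
  mu.-integrable setT (EFin \o (fun u => C * expR (- (k * `|u|)))).
Proof.
move=> k0; rewrite /comp; under eq_fun do rewrite EFinM.
by apply: integrableZl => //; exact: integrable_expR_abs.
Qed.

(* Differentiate [x |-> \int f (y + x) dy], which is constant by translation
   invariance. *)
Lemma cintegral_derivative (f D : R -> R[i]) (C k : R) :
  0 < k -> (forall u, is_cderive f u (D u)) ->
  (forall u, normc (f u) <= C * expR (- (k * `|u|))) ->
  (forall u, normc (D u) <= C * expR (- (k * `|u|))) ->
  cintegral setT D = 0.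
Proof.
move=> k0 fD fub Dub.
have intf : cintegrable setT f.
  exact: le_cintegrable (is_cderive_measurable fD) fub (integrable_cst_expR_abs C k0).
have C0 : 0 <= C.
  by have := le_trans (normc_ge0 _) (fub 0); rewrite pmulr_lge0 ?expR_gt0.
(* The factor [expR k] pays for a translation by |x| < 1, since |y + x| >= |y| - 1. *)
have := @is_cderive_integral (fun x y => f (y + x)) (fun x y => D (y + x)) 0 (-1) 1
   (fun u => C * expR k * expR (- (k * `|u|))).
rewrite oppr_lt0 ltr01 => /(_ isT) H.
have {H} : is_cderive (fun x => cintegral setT (fun y => f (y + x))) 0
   (cintegral setT (fun y => D (y + 0))).
  apply: H.
  - move=> x _; have := cintegrable_affine x ltr01 intf.
    by congr cintegrable; apply/funext => y; rewrite mul1r.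
  - move=> x y _; have := @is_cderive_comp f (fun x => y + x) x _ _ (fD _).
    move=> /(_ 1); rewrite mul1r; apply.
    apply: (is_derive_eq (is_deriveD (is_derive_cst y x 1) (is_derive_id x 1))).
    by rewrite add0r.
  - exact: integrable_cst_expR_abs.
  - move=> x y /andP[x1 x2]; apply: le_trans (Dub _) _.
    rewrite -mulrA ler_wpM2l// -expRD ler_expR.
    have : `|y| <= `|y + x| + `|x| by rewrite -{1}(addrK x y) (le_trans (ler_normB _ _)).
    have : `|x| <= 1 by rewrite ler_norml; lra.
    move=> h1 h2; have := ler_wpM2l (ltW k0) (le_trans h2 (lerD (lexx _) h1)).
    by rewrite mulrDr mulr1; lra.
under eq_fun do rewrite (cintegral_shift _ intf).
move=> /(is_cderive_unique (is_cderive_cst _ _)) ->.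
by apply: eq_cintegral => y; rewrite addr0.
Qed.

(* Cauchy's theorem on a strip, with [f p u] standing for [f (u + i p)]. *)
Lemma contour_shift (f D : R -> R -> R[i]) (al be C k : R) :
  0 < k ->
  (forall p u, al < p < be -> is_cderive (f p) u (D p u)) ->
  (forall p u, al < p < be -> is_cderive (f ^~ u) p ('i%C * D p u)) ->
  (forall p, al < p < be -> cmeasurable (D p)) ->
  (forall p u, al < p < be -> normc (f p u) <= C * expR (- (k * `|u|))) ->
  (forall p u, al < p < be -> normc (D p u) <= C * expR (- (k * `|u|))) ->
  forall p q, al < p < be -> al < q < be ->
  cintegral setT (f p) = cintegral setT (f q).
Proof.
move=> k0 fu fp mD fub Dub p q hp hq.
have intE := integrable_cst_expR_abs C k0.
have intf r : al < r < be -> cintegrable setT (f r).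
  move=> hr; apply: le_cintegrable intE; last by move=> u; exact: fub.
  by apply: (is_cderive_measurable (df := D r)) => x; exact: fu.
have intD r : al < r < be -> cintegrable setT (D r).
  by move=> hr; apply: le_cintegrable (mD r hr) _ intE => u; exact: Dub.
have intD0 r : al < r < be -> cintegral setT (D r) = 0.
  move=> hr; apply: (@cintegral_derivative (f r) (D r) C k k0) => u; last exact: Dub.
    exact: fu.
  exact: fub.
(* Hypothesis [fp] is the Cauchy-Riemann relation: it makes the derivative in the height ['i] times
   the integral of [D r], which is zero by [intD0]. *)
apply: (@is_cderive0_cst (fun p => cintegral setT (f p)) al be p q _ hp hq) => r hr.
have := @is_cderive_integral f (fun p u => 'i%C * D p u) r al be
     (fun u => C * expR (- (k * `|u|))) hr intf fp intE.
rewrite cintegralZl ?intD0 ?mulr0//; last exact: intD.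
apply=> x y hx; rewrite normcM normc_sqrt /= expr0n expr1n add0r sqrtr1 mul1r.
exact: Dub.
Qed.

End DifferentiationUnderIntegral.

(** * The Fourier transform of the Gaussian *)

Section Gaussian.
Variable R : realType.
Notation mu := (@lebesgue_measure R).

(** Completing the square, -t^2 + i t x = -(t - i x / 2)^2 - x^2 / 4; the line at height -x / 2 is
    then moved to the real axis. *)
Lemma cintegral_gauss_fourier (x : R) :
  cintegral setT (fun t => (expR (- t ^+ 2))%:C * cexp (0 +i* (t * x))) =
  (Num.sqrt pi * expR (- (x ^+ 2 / 4)))%:C.
Proof.
pose f p u : R[i] := cexp (- ((u +i* p) * (u +i* p))).
pose D p u : R[i] := - (2 * (u +i* p)) * f p u.
(* Half-width of a strip that contains both heights 0 and -x / 2. *)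
pose M : R := `|x| + 1.
have zd (u p : R) : is_cderive (fun t => t +i* p) u 1.
  by split; [exact: is_derive_id|exact: is_derive_cst].
have zi (u p : R) : is_cderive (fun t => u +i* t) p 'i%C.
  by split; [exact: is_derive_cst|exact: is_derive_id].
have fu p u : is_cderive (f p) u (D p u).
  apply: is_cderive_eq.
    exact: is_cderive_cexp (is_cderiveN (is_cderiveM (zd _ _) (zd _ _))).
  by rewrite /D /f; ring.
have fp p u : is_cderive (f ^~ u) p ('i%C * D p u).
  apply: is_cderive_eq.
    exact: is_cderive_cexp (is_cderiveN (is_cderiveM (zi _ _) (zi _ _))).
  by rewrite /D /f; ring.
have mf p : cmeasurable (f p) by exact: is_cderive_measurable (fu p).
have mD p : cmeasurable (D p).
  apply: cmeasurableM => //; apply: cmeasurableN; apply: cmeasurableM.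
    exact: cmeasurable_cst.
  exact: is_cderive_measurable (fun u => zd u p).
have fn p u : normc (f p u) = expR (p ^+ 2 - u ^+ 2).
  by rewrite /f normc_cexp cReN cReM /=; congr expR; ring.
have M0 : 0 <= M by rewrite /M addr_ge0.
have fub (p u : R) : - M < p < M -> normc (f p u) <= expR (M ^+ 2) * expR (1 - 2 * `|u|).
  move=> hp; rewrite fn -expRD ler_expR.
  have : p ^+ 2 <= M ^+ 2.
    rewrite -[p ^+ 2]real_normK ?num_real// ler_pXn2r ?nnegrE//.
    by rewrite ler_norml; case/andP: hp => /ltW -> /ltW ->.
  (* This square gives u^2 >= 2 |u| - 1, which trades Gaussian decay for exponential decay. *)
  have := sqr_ge0 (`|u| - 1); rewrite sqrrB real_normK ?num_real//.
  lra.
(* The factor 2 |u + i p| of [D] is at most 2 (1 + M) e^|u|, which uses up half of the decay e^(-2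
   |u|). *)
pose C := 2 * (1 + M) * (expR (M ^+ 2) * expR 1).
have C0 : 2 * 1 * (expR (M ^+ 2) * expR 1) <= C.
  by rewrite /C ler_wpM2r ?mulr_ge0 ?expR_ge0//; lra.
have e2 (u : R) : expR (1 - 2 * `|u|) <= expR 1 * expR (- (1 * `|u|)).
  by rewrite -expRD ler_expR; have := normr_ge0 u; lra.
have E0 (u : R) : 0 <= expR (- (1 * `|u|)) by exact: expR_ge0.
have shift := @contour_shift R f D (- M) M C 1 ltr01
  (fun p u _ => fu p u) (fun p u _ => fp p u) (fun p _ => mD p).
have fb (p u : R) : - M < p < M -> normc (f p u) <= C * expR (- (1 * `|u|)).
  move=> hp; apply: le_trans (fub _ _ hp) _.
  apply: le_trans (ler_wpM2l (expR_ge0 _) (e2 u)) _.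
  rewrite mulrA ler_wpM2r//; apply: le_trans C0.
  by rewrite mulr1 ler_peMl ?mulr_ge0 ?expR_ge0//; lra.
have Db (p u : R) : - M < p < M -> normc (D p u) <= C * expR (- (1 * `|u|)).
  move=> hp; rewrite normcM.
  have h1 : normc (- (2 * (u +i* p))) <= 2 * (1 + M) * expR `|u|.
    rewrite (normcN (2 * (u +i* p) : R[i])) normcM.
    have -> : normc (2 : R[i]) = 2.
      by rewrite normc_sqrt /= addr0 expr0n addr0 sqrtr_sqr ger0_norm.
    rewrite -mulrA ler_wpM2l//.
    apply: le_trans (le_normc_Re_Im _) _ => /=.
    have h2 : `|p| <= M by rewrite ler_norml; case/andP: hp => /ltW -> /ltW ->.
    have h3 : 1 + `|u| <= expR `|u| by exact: expR_ge1Dx.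
    have := ler_wpM2l M0 h3; have := normr_ge0 u; nra.
  apply: le_trans (ler_pM (normc_ge0 _) (normc_ge0 _) h1 (fub _ _ hp)) _.
  rewrite /C -!mulrA ler_wpM2l// ler_wpM2l ?addr_ge0//.
  rewrite mulrCA ler_wpM2l ?expR_ge0// -!expRD ler_expR.
  lra.
have hx : - M < - (x / 2) < M.
  rewrite /M; have := ler_norm x; have := ler_norm (- x); rewrite normrN; lra.
have h0 : - M < 0 < M by rewrite /M; have := normr_ge0 x; lra.
have {}shift := shift fb Db _ _ hx h0.
have g0 : cintegral setT (f 0) = (Num.sqrt pi)%:C.
  rewrite /f /cintegral.
  have e t : cexp (- ((t +i* 0) * (t +i* 0))) = (gauss_fun t)%:C :> R[i].
    by rewrite -cexp_real; congr cexp; apply: ReI; rewrite ?cReN ?cImN ?cReM ?cImM /=; ring.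
  under eq_Rintegral do rewrite e.
  under [X in _ +i* X]eq_Rintegral do rewrite e.
  rewrite /= /Rintegral integralT_gauss integral_cst//= mul0e//.
have intf : cintegrable setT (f (- (x / 2))).
  apply: le_cintegrable (mf _) (fun u => fb _ u hx) _.
  exact: integrable_cst_expR_abs.
have -> : (fun t => (expR (- t ^+ 2))%:C * cexp (0 +i* (t * x))) =
   (fun t => (expR (- (x ^+ 2 / 4)))%:C * f (- (x / 2)) t).
  apply/funext => t; rewrite /f -!cexp_real -!cexpD; congr cexp.
  by apply: ReI; rewrite !(cReD, cImD, cReN, cImN, cReM, cImM) /=; field.
by rewrite cintegralZl// shift g0 -rmorphM mulrC.
Qed.

End Gaussian.

(** * Fourier inversion for continuous functions with integrable transform *)

Section FourierInversion.
Variable R : realType.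
Notation mu := (@lebesgue_measure R).

Lemma normc_cexp_im (x : R) : normc (cexp (0 +i* x)) = 1.
Proof. by rewrite normc_cexp /= expR0. Qed.

Lemma ccvg_unique (u : nat -> R[i]) (l l' : R[i]) : ccvg u l -> ccvg u l' -> l = l'.
Proof.
move=> [u1 u2] [v1 v2]; apply: ReI.
  by apply: (cvg_unique (@Rhausdorff R) u1 v1).
by apply: (cvg_unique (@Rhausdorff R) u2 v2).
Qed.

Lemma ccvgM (u v : nat -> R[i]) (l l' : R[i]) : ccvg u l -> ccvg v l' ->
  ccvg (fun n => u n * v n) (l * l').
Proof.
move=> [u1 u2] [v1 v2]; split.
  under eq_fun do rewrite cReM; rewrite cReM.
  by apply: cvgB; apply: cvgM.
under eq_fun do rewrite cImM; rewrite cImM.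
by apply: cvgD; apply: cvgM.
Qed.

Lemma ccvg_cst (l : R[i]) : ccvg (fun=> l) l.
Proof. by split; exact: cvg_cst. Qed.

Lemma ccvg_real (u : nat -> R) (l : R) : u n @[n --> \oo] --> l ->
  ccvg (fun n => (u n)%:C) l%:C.
Proof. by move=> ul; split; [exact: ul|exact: cvg_cst]. Qed.

Lemma cmeasurable_cexp_im d (T : measurableType d) (h : T -> R) :
  measurable_fun setT h -> cmeasurable (fun x => cexp (0 +i* h x)).
Proof.
move=> mh; apply: cmeasurable_cexp; split => //=; exact: measurable_cst.
Qed.

Lemma cmeasurable_pair2 (f : R * R -> R[i]) (x : R) :
  cmeasurable f -> cmeasurable (fun y : R => f (x, y)).
Proof.
move=> [f1 f2]; split; [apply: (measurableT_comp f1)|apply: (measurableT_comp f2)];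
  apply: measurable_fun_pair => //.
Qed.

Lemma cmeasurable_pair1 (f : R * R -> R[i]) (y : R) :
  cmeasurable f -> cmeasurable (fun x : R => f (x, y)).
Proof.
move=> [f1 f2]; split; [apply: (measurableT_comp f1)|apply: (measurableT_comp f2)];
  apply: measurable_fun_pair => //.
Qed.

Lemma cvg_harmonicM (x : R) : x * (n.+1%:R^-1 : R) @[n --> \oo] --> 0.
Proof.
rewrite -[X in _ --> X](mulr0 x); apply: cvgM; first exact: cvg_cst.
exact: cvg_harmonic.
Qed.

Lemma integrable_gauss_scale (e : R) : 0 < e ->
  mu.-integrable setT (EFin \o (fun t => expR (- (e * t) ^+ 2))).
Proof.
move=> e0; have := integrable_affine 0 e0 (@integrableT_gauss R).
by congr (_.-integrable _ _); apply/funext => t; rewrite /= /gauss_fun addr0.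
Qed.

Lemma cintegrable_gauss_fourier_scale (e x : R) : 0 < e ->
  cintegrable setT (fun t => (expR (- (e * t) ^+ 2))%:C * cexp (0 +i* (t * x))).
Proof.
move=> e0; have ig := integrable_gauss_scale e0.
apply: le_cintegrable ig.
  apply: cmeasurableM.
    apply: cmeasurable_real.
    by have := measurable_int _ (integrable_gauss_scale e0); move/measurable_EFinP.
  by apply: cmeasurable_cexp_im; exact: measurable_funM.
move=> t; rewrite normcM normc_cexp_im mulr1 normc_real ger0_norm//.
Qed.

Lemma cintegral_gauss_fourier_scale (e x : R) : 0 < e ->
  cintegral setT (fun t => (expR (- (e * t) ^+ 2))%:C * cexp (0 +i* (t * x))) =
  (e^-1 * (Num.sqrt pi * expR (- ((x / e) ^+ 2 / 4))))%:C.
Proof.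
move=> e0.
transitivity ((e^-1)%:C * (Num.sqrt pi * expR (- ((x / e) ^+ 2 / 4)))%:C); last by rewrite -rmorphM.
rewrite -cintegral_gauss_fourier.
pose F t : R[i] := (expR (- t ^+ 2))%:C * cexp (0 +i* (t * (x / e))).
have iF : cintegrable setT F.
  apply: le_cintegrable (@integrableT_gauss R).
    apply: cmeasurableM; first by apply: cmeasurable_real; exact: measurable_gauss_fun.
    by apply: cmeasurable_cexp_im; exact: measurable_funM.
  move=> t; rewrite /F normcM normc_cexp_im mulr1 normc_real ger0_norm//.
rewrite (cintegral_affine 0 e0 iF) mulrA -rmorphM mulVf ?gt_eqF// mul1r.
apply: eq_cintegral => t; rewrite /F addr0; congr (_ * cexp (_ +i* _)).
by field; rewrite gt_eqF.
Qed.

(** Gaussian regularization. With the factor [K n] inserted, Fubini's theorem turns the integral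
    into a Gaussian average of [g] around [y], of width proportional to [eps n]. Both expressions of
    [A n] then converge by domination: the first by |gh|, the second by [C] times a Gaussian. *)
Lemma fourier_inversion (g : R -> R[i]) (y C : R) :
  continuous (fun u => Re (g u)) -> continuous (fun u => Im (g u)) ->
  (forall u, normc (g u) <= C) -> cintegrable setT g ->
  let gh := fun t => cintegral setT (fun u => g u * cexp (0 +i* (t * u))) in
  cintegrable setT gh ->
  cintegral setT (fun t => gh t * cexp (0 +i* (- (t * y)))) = (2 * pi)%:C * g y.
Proof.
move=> cg1 cg2 gC ig gh igh.
have mg := cintegrable_measurable ig.
have mgh := cintegrable_measurable igh.
pose eps n : R := n.+1%:R^-1.
have eps0 n : 0 < eps n by rewrite invr_gt0.
pose K n t : R := expR (- (eps n * t) ^+ 2).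
have mK n : measurable_fun setT (K n).
  by have := measurable_int _ (integrable_gauss_scale (eps0 n)); move/measurable_EFinP.
have K0 n t : 0 <= K n t by exact: expR_ge0.
have K1 n t : K n t <= 1 by rewrite /K -expR0 ler_expR oppr_le0 sqr_ge0.
pose A n := cintegral setT (fun t => (K n t)%:C * (gh t * cexp (0 +i* (- (t * y))))).
have me : cmeasurable (fun t : R => cexp (0 +i* (- (t * y)))).
  apply: cmeasurable_cexp_im; apply: measurableT_comp => //; exact: measurable_funM.
have A1 : ccvg A (cintegral setT (fun t => gh t * cexp (0 +i* (- (t * y))))).
  have [||||_ //] := @cdominated_convergence R
    (fun n t => (K n t)%:C * (gh t * cexp (0 +i* (- (t * y)))))
    (fun t => gh t * cexp (0 +i* (- (t * y)))) (fun t => normc (gh t)).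
  - move=> n; apply: cmeasurableM; first exact: cmeasurable_real.
    exact: cmeasurableM.
  - move=> t; rewrite -[X in ccvg _ X]mul1r; apply: ccvgM; last exact: ccvg_cst.
    apply: ccvg_real.
    have h : - ((t * eps n) * (t * eps n)) @[n --> \oo] --> (- (0 * 0) : R).
      by apply: cvgN; apply: cvgM; exact: cvg_harmonicM.
    rewrite (_ : (fun n => K n t) = expR \o (fun n => - ((t * eps n) * (t * eps n)))).
      have -> : 1 = expR (- (0 * 0)) :> R by rewrite mulr0 oppr0 expR0.
      exact: cvg_comp _ _ h (@continuous_expR R _).
    by apply/funext => n /=; rewrite /K expr2 (mulrC t).
  - exact: integrable_normc.
  - move=> n t; rewrite normcM normcM normc_cexp_im mulr1 normc_real ger0_norm//.
    by rewrite ler_piMl ?normc_ge0.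
have mgg (n : nat) : cmeasurable (fun v : R => (expR (- v ^+ 2))%:C * g (2 * eps n * v + y)).
  apply: cmeasurableM; first by apply: cmeasurable_real; exact: measurable_gauss_fun.
  by apply: cmeasurable_comp mg _; apply: measurable_funD => //; exact: measurable_funM.
have nggC (n : nat) (v : R) :
    normc ((expR (- v ^+ 2))%:C * g (2 * eps n * v + y)) <= C * expR (- v ^+ 2).
  rewrite normcM normc_real ger0_norm ?expR_ge0// mulrC.
  by rewrite ler_wpM2r ?expR_ge0.
have iC : mu.-integrable setT (EFin \o (fun v : R => C * expR (- v ^+ 2))).
  rewrite /comp; under eq_fun do rewrite EFinM.
  by apply: integrableZl => //; exact: integrableT_gauss.
have igg (n : nat) : cintegrable setT (fun v : R => (expR (- v ^+ 2))%:C * g (2 * eps n * v + y)).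
  exact: le_cintegrable (mgg n) (nggC n) iC.
have A2 n : A n = (2 * Num.sqrt pi)%:C *
    cintegral setT (fun v => (expR (- v ^+ 2))%:C * g (2 * eps n * v + y)).
  pose f (z : R * R) : R[i] := (K n z.1)%:C * (g z.2 * cexp (0 +i* (z.1 * (z.2 - y)))).
  have mf : cmeasurable f.
    apply: cmeasurableM.
      by apply: cmeasurable_real; apply: measurableT_comp.
    apply: cmeasurableM; first exact: cmeasurable_comp.
    apply: cmeasurable_cexp_im; apply: measurable_funM => //.
    exact: measurable_funB.
  have nf z : normc (f z) = K n z.1 * normc (g z.2).
    by rewrite /f normcM normcM normc_cexp_im mulr1 normc_real ger0_norm.
  have if1 t : cintegrable setT (fun u => f (t, u)).
    apply: (@le_cintegrable _ _ (fun u => K n t * normc (g u))).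
    - exact: cmeasurable_pair2.
    - by move=> u; rewrite nf.
    - rewrite /comp; under eq_fun do rewrite EFinM.
      by apply: integrableZl => //; exact: integrable_normc.
  have if2 u : cintegrable setT (fun t => f (t, u)).
    apply: (@le_cintegrable _ _ (fun t => normc (g u) * K n t)).
    - exact: cmeasurable_pair1.
    - by move=> t; rewrite nf mulrC.
    - rewrite /comp; under eq_fun do rewrite EFinM.
      by apply: integrableZl => //; exact: integrable_gauss_scale.
  have -> : A n = cintegral setT (fun t => cintegral setT (fun u => f (t, u))).
    apply: eq_cintegral => t; rewrite /gh /f /=.
    rewrite [in RHS](_ : (fun u => _) = (fun u => ((K n t)%:C * cexp (0 +i* (- (t * y)))) *
       (g u * cexp (0 +i* (t * u))))); last first.
       apply/funext => u.
      have -> : 0 +i* (t * (u - y)) = (0 +i* (- (t * y))) + (0 +i* (t * u)) :> R[i].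
        by apply: ReI => /=; ring.
      by rewrite cexpD; ring.
    rewrite cintegralZl; first by ring.
    apply: le_cintegrable (integrable_normc ig).
      apply: cmeasurableM => //; apply: cmeasurable_cexp_im; exact: measurable_funM.
    by move=> u; rewrite normcM normc_cexp_im mulr1.
  (* The double integral of |f| is the product of the integrals of [K n] and of |g|. *)
  rewrite cfubini//; last first.
    have fin := integrable_fin_num measurableT (integrable_normc ig).
    have finK := integrable_fin_num measurableT (integrable_gauss_scale (eps0 n)).
    rewrite (_ : (\int[mu]_x _ = \int[mu]_t ((K n t)%:E *
        (fine (\int[mu]_u (normc (g u))%:E))%:E))%E); last first.
      apply: eq_integral => t _; rewrite fineK// -integralZl//; last exact: integrable_normc.
      by apply: eq_integral => u _; rewrite nf.
    rewrite integralZr//; last exact: integrable_gauss_scale.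
    by rewrite -(fineK finK) -EFinM ltry.
  pose h u : R[i] := ((eps n)^-1 * (Num.sqrt pi * expR (- (((u - y) / eps n) ^+ 2 / 4))))%:C * g u.
  have -> : cintegral setT (fun u => cintegral setT (fun t => f (t, u))) = cintegral setT h.
    apply: eq_cintegral => u; rewrite /f /= /h -cintegral_gauss_fourier_scale//.
    rewrite mulrC -cintegralZl; last exact: cintegrable_gauss_fourier_scale.
    by apply: eq_cintegral => t; rewrite /K; ring.
  have ih : cintegrable setT h.
    apply: (@le_cintegrable _ _ (fun u => ((eps n)^-1 * Num.sqrt pi) * normc (g u))).
    - apply: cmeasurableM => //; apply: cmeasurable_real.
      do 2 apply: measurable_funM => //; apply: measurableT_comp; first exact: measurable_expR.
      apply: measurableT_comp => //; apply: measurable_funM => //; apply: measurable_funX.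
      by apply: measurable_funM => //; exact: measurable_funB.
    - move=> u; rewrite /h normcM normc_real ler_wpM2r ?normc_ge0//.
      rewrite mulrA normrM ger0_norm ?mulr_ge0 ?invr_ge0 ?sqrtr_ge0//.
      rewrite ler_piMr ?mulr_ge0 ?invr_ge0 ?sqrtr_ge0//.
      rewrite ger0_norm ?expR_ge0// -expR0 ler_expR oppr_le0.
      by rewrite mulr_ge0 ?sqr_ge0.
    - rewrite /comp; under eq_fun do rewrite EFinM.
      by apply: integrableZl => //; exact: integrable_normc.
  have e2 : 0 < 2 * eps n by rewrite mulr_gt0.
  (* The substitution u = 2 eps v + y makes the Gaussian weight independent of [n], leaving [n] only
     in the argument of [g]. *)
  rewrite (cintegral_affine y e2 ih).
  rewrite (_ : (fun u => h _) = (fun v => ((eps n)^-1 * Num.sqrt pi)%:C *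
     ((expR (- v ^+ 2))%:C * g (2 * eps n * v + y)))); last first.
    apply/funext => v; rewrite /h addrK.
    have -> : (2 * eps n * v / eps n) ^+ 2 / 4 = v ^+ 2.
      by field; rewrite gt_eqF.
    by rewrite !rmorphM; ring.
  rewrite cintegralZl; last exact: igg.
  rewrite mulrA -rmorphM; congr (_%:C * _).
  by field; rewrite gt_eqF.
(* By continuity of [g] at [y]. The second sqrt pi is the mass of the Gaussian, that is its
   transform at 0; together the factors give 2 pi. *)
have A3 : ccvg A ((2 * Num.sqrt pi)%:C * ((Num.sqrt pi)%:C * g y)).
  rewrite (funext A2).
  apply: ccvgM; first exact: ccvg_cst.
  have [||||_] := @cdominated_convergence R
    (fun n v => (expR (- v ^+ 2))%:C * g (2 * eps n * v + y))
    (fun v => (expR (- v ^+ 2))%:C * g y) (fun v => C * expR (- v ^+ 2)).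
  - exact: mgg.
  - move=> v; apply: ccvgM; first exact: ccvg_cst.
    have cv : 2 * eps n * v + y @[n --> \oo] --> y.
      rewrite -[X in _ --> X]add0r; apply: cvgD; last exact: cvg_cst.
      by under eq_fun do rewrite mulrAC; exact: cvg_harmonicM.
    by split; [exact: (cvg_comp _ _ cv (cg1 y))|exact: (cvg_comp _ _ cv (cg2 y))].
  - exact: iC.
  - exact: nggC.
  congr ccvg.
  rewrite (_ : (fun v => _) = (fun v => g y * (expR (- v ^+ 2))%:C)); last first.
    by apply/funext => v; rewrite mulrC.
  rewrite cintegralZl; last first.
    by split => /=; [exact: integrableT_gauss|exact: integrable0].
  rewrite mulrC; congr (_ * _).
  have := @cintegral_gauss_fourier R 0; rewrite expr0n mul0r oppr0 expR0 mulr1 => <-.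
  by apply: eq_cintegral => v; rewrite mulr0 cexp0 mulr1.
rewrite (ccvg_unique A1 A3) mulrA -rmorphM -mulrA -expr2 sqr_sqrtr//.
exact: pi_ge0.
Qed.

End FourierInversion.

(** * The substitution t = e^u from ]0, +oo[ to the whole line *)

Section ExpSubstitution.
Variable R : realType.
Notation mu := (@lebesgue_measure R).

Lemma derive1_ln (x : R) : 0 < x -> derive1 (@ln R) x = x^-1.
Proof. by move=> x0; rewrite derive1E; have [] := is_derive1_ln x0. Qed.

Lemma continuous_derive1_ln (x : R) : 0 < x -> {for x, continuous (derive1 (@ln R))}.
Proof.
move=> x0; change (derive1 (@ln R) y @[y --> x] --> derive1 (@ln R) x).
rewrite derive1_ln//.
apply: cvg_trans; last exact: (cvgV (lt0r_neq0 x0) cvg_id).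
apply: near_eq_cvg; near=> y; rewrite derive1_ln//.
by near: y; exact: lt_nbhsr.
Unshelve. all: by end_near. Qed.

Lemma cvg_derive1_ln_pinfty : derive1 (@ln R) x @[x --> +oo%R] --> 0.
Proof.
have h : (x : R)^-1 @[x --> +oo%R] --> (0 : R).
  apply/(gtr0_cvgV0 (f := id)); last exact: cvg_id.
  by near=> x; near: x; exact: nbhs_pinfty_gt.
apply: cvg_trans h; apply: near_eq_cvg; near=> y; rewrite derive1_ln//.
Unshelve. all: by end_near. Qed.

Lemma cvg_ln_pinfty : ln x @[x --> +oo%R] --> (+oo%R : set_system R).
Proof.
apply/cvgryPge => A; near=> x.
have h : expR A <= x by near: x; exact: nbhs_pinfty_ge.
by rewrite -(expRK A) ler_ln ?posrE ?expR_gt0// (lt_le_trans (expR_gt0 A)).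
Unshelve. all: by end_near. Qed.

(** The logarithm is singular at 0, so the substitution is made on [e^(-n), +oo[; monotone
    convergence on both sides then exhausts ]0, +oo[. *)
Lemma ge0_integral_expR_subst (G : R -> R) : continuous G -> (forall x, 0 <= G x) ->
  (\int[mu]_(t in `]0%R, +oo[) (G (ln t) / t)%:E = \int[mu]_x (G x)%:E)%E.
Proof.
move=> cG G0.
have mG : measurable_fun setT (fun x => (G x)%:E).
  by apply/measurable_EFinP; exact: continuous_measurable_fun.
have mGl : measurable_fun (`]0, +oo[%classic : set R) (fun t : R => (G (ln t) / t)%:E).
  apply/measurable_EFinP; apply: open_continuous_measurable_fun.
    exact: interval_open.
  move=> x; rewrite inE/= in_itv/= andbT => x0.
  apply: continuousM; last by apply: continuousV; [rewrite gt_eqF|exact: cvg_id].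
  by apply: continuous_comp; [exact: continuous_ln|exact: cG].
pose a n : R := expR (- n%:R).
have a0 n : 0 < a n by exact: expR_gt0.
have key n : (\int[mu]_(t in `[a n, +oo[) (G (ln t) / t)%:E =
    \int[mu]_(x in `[(- n%:R)%R, +oo[) (G x)%:E)%E.
  have an : ln (a n) = - n%:R by rewrite expRK.
  rewrite -an (@increasing_ge0_integration_by_substitutiony R (@ln R) G (a n)).
  - apply: eq_integral => x; rewrite inE/= in_itv/= andbT => ax.
    congr EFin; rewrite -[RHS]/(G (ln x) * derive1 (@ln R) x) derive1_ln//.
    exact: lt_le_trans ax.
  - move=> x y; rewrite !in_itv/= !andbT => ax ay xy.
    by rewrite ltr_ln// posrE (lt_le_trans (a0 n)).
  - by move=> x; rewrite in_itv/= andbT => ax; apply: continuous_derive1_ln; exact: lt_trans ax.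
  - apply/cvg_ex; exists (derive1 (@ln R) (a n)).
    by apply: cvg_at_right_filter; exact: continuous_derive1_ln.
  - by apply/cvg_ex; exists 0; exact: cvg_derive1_ln_pinfty.
  - split.
    + move=> x; rewrite in_itv/= andbT => ax.
      by have [] := is_derive1_ln (lt_trans (a0 n) ax).
    + apply: cvg_at_right_filter; exact: continuous_ln.
  - exact: cvg_ln_pinfty.
  - exact: continuous_subspaceT.
  - by move=> x _; exact: G0.
have c1 : (\int[mu]_(t in `[a n, +oo[) (G (ln t) / t)%:E @[n --> \oo] -->
    \int[mu]_(t in \bigcup_n (`[a n, +oo[%classic : set R)) (G (ln t) / t)%:E)%E.
  apply: ge0_nondecreasing_set_cvg_integral => //.
  - move=> m n mn; apply/subsetPset => x /=; rewrite !in_itv/= !andbT.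
    by apply: le_trans; rewrite ler_expR lerN2 ler_nat.
  - move=> n; apply: measurable_funS mGl => // x /=; rewrite !in_itv/= !andbT.
    exact: lt_le_trans.
  - move=> n x /=; rewrite in_itv/= andbT => ax.
    by rewrite lee_fin divr_ge0// (le_trans _ ax)// ltW.
have c2 : (\int[mu]_(x in `[(- n%:R)%R, +oo[) (G x)%:E @[n --> \oo] -->
    \int[mu]_(x in \bigcup_n (`[(- n%:R)%R, +oo[%classic : set R)) (G x)%:E)%E.
  apply: ge0_nondecreasing_set_cvg_integral => //.
  - move=> m n mn; apply/subsetPset => x /=; rewrite !in_itv/= !andbT.
    by apply: le_trans; rewrite lerN2 ler_nat.
  - by move=> n; apply: measurable_funS mG.
  - by move=> n x _; rewrite lee_fin.
rewrite (funext key) in c1.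
have e1 : \bigcup_n (`[a n, +oo[%classic : set R) = `]0, +oo[%classic.
  apply/seteqP; split => x /=.
    by move=> [n _] /=; rewrite !in_itv/= !andbT; exact: lt_le_trans.
  rewrite in_itv/= andbT => x0; exists (Num.truncn `|ln x|).+1 => //=.
  rewrite in_itv/= andbT -ler_ln ?posrE// expRK.
  rewrite lerNl (le_trans (ler_norm _))// normrN ltW// truncnS_gt//.
have e2 : \bigcup_n (`[- n%:R, +oo[%classic : set R) = setT.
  apply/seteqP; split => x //= _; exists (Num.truncn `|x|).+1 => //=.
  rewrite in_itv/= andbT.
  rewrite lerNl (le_trans (ler_norm _))// normrN ltW// truncnS_gt//.
rewrite e1 in c1; rewrite e2 in c2.
exact: (cvg_unique (@ereal_hausdorff R) c1 c2).
Qed.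

(** The positive and negative parts, written as maxima with 0, remain continuous, so the nonnegative
    case applies to each. *)
Lemma Rintegral_expR_subst (G : R -> R) : continuous G ->
  \int[mu]_(t in `]0%R, +oo[) (G (ln t) / t) = \int[mu]_x (G x).
Proof.
move=> cG; rewrite /Rintegral; congr fine; rewrite integralE [in RHS]integralE.
have cmax (H : R -> R) : continuous H -> continuous (fun x => Num.max (H x) 0).
  by move=> cH x; apply: continuous_max; [exact: cH|exact: cst_continuous].
have cp := cmax G cG.
have cn : continuous (fun x => Num.max (- G x) 0).
  by apply: cmax => x; apply: cvgN; exact: cG.
congr (_ - _)%E.
  rewrite (_ : (\int[mu]_x _ = \int[mu]_x (Num.max (G x) 0)%:E)%E); last first.
    by apply: eq_integral => x _; rewrite funeposE EFin_max.
  rewrite -ge0_integral_expR_subst//; last by move=> x; rewrite le_max lexx orbT.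
  apply: eq_integral => x; rewrite inE/= in_itv/= andbT => x0.
  by rewrite funeposE -EFin_max maxr_pMl ?invr_ge0 ?ltW// mul0r.
rewrite (_ : (\int[mu]_x _ = \int[mu]_x (Num.max (- G x) 0)%:E)%E); last first.
  by apply: eq_integral => x _; rewrite funenegE EFin_max.
rewrite -ge0_integral_expR_subst//; last by move=> x; rewrite le_max lexx orbT.
apply: eq_integral => x; rewrite inE/= in_itv/= andbT => x0.
by rewrite funenegE -EFin_max maxr_pMl ?invr_ge0 ?ltW// mul0r mulNr.
Qed.

End ExpSubstitution.

(** * The Gamma function on the line, its functional equation and the beta integral *)

Section Gamma.
Variable R : realType.
Notation mu := (@lebesgue_measure R).

Implicit Types (z w s v : R[i]).

(* The integrand of [cGamma z] after the substitution [t = e^u]. *)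
Definition gammak (z : R[i]) (u : R) : R[i] := cexp (z * u%:C - (expR u)%:C).

Lemma is_cderive_gammak z u :
  is_cderive (gammak z) u ((z - (expR u)%:C) * gammak z u).
Proof.
apply: is_cderive_eq.
  apply: is_cderive_cexp; apply: is_cderiveD.
    exact: is_cderiveM (is_cderive_cst z u) (is_cderive_real u).
  apply: is_cderiveN.
  have -> : (fun t : R => (expR t)%:C) = (fun t => cexp t%:C).
    by apply/funext => t; rewrite cexp_real.
  exact: is_cderive_cexp (is_cderive_real u).
by rewrite cexp_real /gammak; ring.
Qed.

Lemma normc_gammak z u : normc (gammak z u) = expR (Re z * u - expR u).
Proof. by rewrite normc_cexp cReD cReN cReM /= mulr0 subr0. Qed.

Lemma gammakD z w u : gammak (z + w) u = cexp (w * u%:C) * gammak z u.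
Proof. by rewrite /gammak -cexpD; congr cexp; ring. Qed.

Lemma cGammaE z : cGamma z = cintegral setT (gammak z).
Proof.
have key (G : R -> R) (h : R -> R) : continuous G ->
    (forall t, 0 < t -> h t = G (ln t) / t) ->
    \int[mu]_(t in `]0%R, +oo[) h t = \int[mu]_x G x.
  move=> cG hG; rewrite -Rintegral_expR_subst//; apply: eq_Rintegral => t.
  by rewrite inE/= in_itv/= andbT => /hG.
have e t : 0 < t -> cpow t%:C (z - 1) * (expR (- t))%:C = gammak z (ln t) * (t^-1)%:C.
  move=> t0; rewrite /cpow clog_real// -cexp_real /gammak lnK//.
  have -> : (t^-1)%:C = cexp (- (ln t)%:C) by rewrite cexpN cexp_real lnK// rmorphV ?unitfE ?gt_eqF.
  by rewrite -!cexpD; congr cexp; rewrite rmorphN; ring.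
rewrite /cGamma /cintegral; apply: ReI => /=.
- apply: (key (fun u => Re (gammak z u))) => [u|t t0].
    by case: (is_cderive_continuous (is_cderive_gammak z u)).
  by rewrite e// cReM /= mulr0 subr0.
- apply: (key (fun u => Im (gammak z u))) => [u|t t0].
    by case: (is_cderive_continuous (is_cderive_gammak z u)).
  by rewrite e// cImM /= mulr0 add0r.
Qed.

(** For u <= 0 the term e^u is dropped. For u > 0 the tangent to the exponential at ln N, with N = x
    + 1, gives x u - e^u <= M - u. *)
Lemma expR_gamma_bound (x : R) : 0 < x -> exists (C k : R), [/\ 0 < C, 0 < k, k <= x &
  forall u, expR (x * u - expR u) <= C * expR (- (k * `|u|))].
Proof.
move=> x0; pose N := x + 1; have N0 : 0 < N by rewrite /N; lra.
pose M := N * (ln N - 1).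
exists (1 + expR M), (Num.min x 1); split => [||//|u].
- by rewrite ltr_pwDl// expR_ge0.
- by rewrite lt_min x0 ltr01.
- by rewrite ge_min lexx.
have k1 : Num.min x 1 <= x by rewrite ge_min lexx.
have k2 : Num.min x 1 <= 1 by rewrite ge_min lexx orbT.
set k := Num.min x 1 in k1 k2 *.
have e1 : 0 <= expR M by exact: expR_ge0.
have [u0|u0] := leP u 0.
  apply: (@le_trans _ _ (1 * expR (- (k * `|u|)))); last first.
    by rewrite ler_wpM2r ?expR_ge0//; lra.
  rewrite mul1r ler_expR ler0_norm//.
  have := expR_ge0 u; nra.
apply: (@le_trans _ _ (expR M * expR (- (k * `|u|)))); last first.
  by rewrite ler_wpM2r ?expR_ge0//; lra.
rewrite -expRD ler_expR gtr0_norm// /M.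
have h : N * (1 + (u - ln N)) <= expR u.
  have -> : expR u = N * expR (u - ln N).
    by rewrite expRB lnK ?posrE// mulrC divfK// gt_eqF.
  by rewrite ler_wpM2l ?(ltW N0)// expR_ge1Dx.
have : k * u <= u by rewrite ler_piMl// ltW.
rewrite /N in h *; nra.
Qed.

Lemma cmeasurable_gammak z : cmeasurable (gammak z).
Proof. exact: is_cderive_measurable (is_cderive_gammak z). Qed.

Lemma cintegrable_gammak z : 0 < Re z -> cintegrable setT (gammak z).
Proof.
move=> z0; have [C [k [C0 k0 _ ub]]] := expR_gamma_bound z0.
apply: le_cintegrable (cmeasurable_gammak z) _ (integrable_cst_expR_abs C k0) => u.
by rewrite normc_gammak.
Qed.

(** Integration by parts: [z * gammak z - gammak (z + 1)] is the derivative of [gammak z], so its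
    integral vanishes. *)
Lemma cGamma_add1 z : 0 < Re z -> cGamma (z + 1) = z * cGamma z.
Proof.
move=> z0; rewrite !cGammaE.
have z1 : 0 < Re (z + 1) by rewrite cReD /=; lra.
have [C1 [k1 [C10 k10 _ ub1]]] := expR_gamma_bound z0.
have [C2 [k2 [C20 k20 _ ub2]]] := expR_gamma_bound z1.
pose k := Num.min k1 k2; pose C := C1 * (normc z + 1) + C2.
have k0 : 0 < k by rewrite lt_min k10.
have kb1 (u : R) : expR (- (k1 * `|u|)) <= expR (- (k * `|u|)).
  by rewrite ler_expR lerN2 ler_wpM2r// ge_min lexx.
have kb2 (u : R) : expR (- (k2 * `|u|)) <= expR (- (k * `|u|)).
  by rewrite ler_expR lerN2 ler_wpM2r// ge_min lexx orbT.
have dE u : (z - (expR u)%:C) * gammak z u = z * gammak z u + (-1) * gammak (z + 1) u.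
  by rewrite gammakD mul1r cexp_real; ring.
have n0 := normc_ge0 z.
have := @cintegral_derivative R (gammak z) (fun u => z * gammak z u + (-1) * gammak (z + 1) u) C k k0.
rewrite cintegralD; [|exact: cintegrableZl (cintegrable_gammak _)..].
rewrite !cintegralZl; [|exact: cintegrable_gammak..].
move=> H; apply/esym/eqP; rewrite -subr_eq0 -mulN1r; apply/eqP; apply: H => u.
- by apply: is_cderive_eq (is_cderive_gammak z u) (dE u).
- rewrite normc_gammak; apply: le_trans (ub1 u) _.
  apply: le_trans (ler_wpM2l (ltW C10) (kb1 u)) _.
  rewrite ler_wpM2r ?expR_ge0// /C; nra.
- apply: le_trans (normcD _ _) _; rewrite mulN1r (normcN (gammak _ u)) normcM !normc_gammak.
  have := ler_wpM2l (ltW C20) (kb2 u); have := ler_wpM2l (ltW C10) (kb1 u).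
  move=> h1 h2; have := le_trans (ub1 u) h1; have := le_trans (ub2 u) h2.
  rewrite /C; set E := expR (- (k * _)) => h3 h4.
  have E0 : 0 <= E by exact: expR_ge0.
  have := ler_wpM2l n0 h4; have := mulr_ge0 (ltW C10) E0; nra.
Qed.

(** The decay rate is x at -oo, where the logarithm is only nonnegative, and y - x at +oo, where it
    is at least u. *)
Lemma expR_beta_bound (x y u : R) : 0 < x < y ->
  expR (x * u - y * ln (1 + expR u)) <= expR (- (Num.min x (y - x) * `|u|)).
Proof.
move=> /andP[x0 xy]; rewrite ler_expR.
have p0 : 0 < 1 + expR u by rewrite ltr_wpDr ?expR_ge0.
have k1 : Num.min x (y - x) <= x by rewrite ge_min lexx.
have k2 : Num.min x (y - x) <= y - x by rewrite ge_min lexx orbT.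
set k := Num.min _ _ in k1 k2 *.
have [u0|u0] := leP u 0.
  have h : 0 <= ln (1 + expR u) by rewrite ln_ge0// lerDl expR_ge0.
  by rewrite ler0_norm//; nra.
have h : u <= ln (1 + expR u).
  by rewrite -[leLHS]expRK ler_ln ?posrE ?expR_gt0// lerDr.
by rewrite gtr0_norm//; nra.
Qed.

(** In the product of the two integrals, the variable of Gamma(v) is shifted by that of Gamma(s -
    v). Since e^y + e^(u + y) = e^(y + ln (1 + e^u)), integrating in y first produces Gamma(s),
    again by translation invariance. *)
Lemma cGamma_beta s v : 0 < Re v -> 0 < Re (s - v) ->
  cGamma v * cGamma (s - v) =
  cGamma s * cintegral setT (fun u => cexp (v * u%:C - s * (ln (1 + expR u))%:C)).
Proof.
move=> v0 sv0; rewrite !cGammaE.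
have s0 : 0 < Re s by move: sv0; rewrite cReD cReN; lra.
pose f (z : R * R) : R[i] := gammak (s - v) z.1 * gammak v (z.2 + z.1).
have shift (w : R[i]) (d : R) : 0 < Re w -> cintegrable setT (fun u => gammak w (u + d)).
  move=> w0; have := cintegrable_affine d ltr01 (cintegrable_gammak w0).
  by congr cintegrable; apply/funext => u; rewrite mul1r.
have fE y u : f (y, u) = cexp (v * u%:C - s * (ln (1 + expR u))%:C) * gammak s (y + ln (1 + expR u)).
  rewrite /f /gammak -!cexpD; congr cexp.
  have p0 : 0 < 1 + expR u by rewrite ltr_wpDr ?expR_ge0.
  rewrite !rmorphD /= !expRD lnK ?posrE// !rmorphM rmorphD /=.
  by rewrite rmorph1; ring.
have mf : cmeasurable f.
  apply: cmeasurableM; first exact: cmeasurable_comp (cmeasurable_gammak _) _.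
  by apply: cmeasurable_comp (cmeasurable_gammak _) _; exact: measurable_funD.
have if1 y : cintegrable setT (fun u => f (y, u)) by exact: (cintegrableZl (gammak (s - v) y) (shift v y v0)).
have if2 u : cintegrable setT (fun y => f (y, u)).
  under eq_fun do rewrite fE; exact: (cintegrableZl (cexp (v * u%:C - s * (ln (1 + expR u))%:C)) (shift s _ s0)).
transitivity (cintegral setT (fun y => cintegral setT (fun u => f (y, u)))).
  rewrite -cintegralZl; last exact: cintegrable_gammak.
  apply: eq_cintegral => y; rewrite /f /= cintegralZl; last exact: shift.
  by rewrite (cintegral_shift y (cintegrable_gammak v0)) mulrC.
rewrite cfubini//; last first.
  have fin w : 0 < Re w -> (\int[mu]_x (normc (gammak w x))%:E)%E \is a fin_num.
    move=> w0; exact: (integrable_fin_num measurableT (integrable_normc (cintegrable_gammak w0))).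
  rewrite (_ : (\int[mu]_x _ = \int[mu]_y ((normc (gammak (s - v) y))%:E *
      (fine (\int[mu]_u (normc (gammak v u))%:E))%:E))%E); last first.
    apply: eq_integral => y _; rewrite fineK ?fin//.
    rewrite [in RHS](integral_affine y ltr01 (integrable_normc (cintegrable_gammak v0))).
    rewrite mul1e -integralZl//; last first.
      have := integrable_normc (shift v y v0).
      by congr (_.-integrable _ _); apply/funext => u /=; rewrite mul1r.
    by apply: eq_integral => u _; rewrite /f normcM mul1r.
  rewrite integralZr//; last exact: (integrable_normc (cintegrable_gammak sv0)).
  by rewrite -(fineK (fin _ sv0)) -EFinM ltry.
have ib : cintegrable setT (fun u => cexp (v * u%:C - s * (ln (1 + expR u))%:C)).
  have vs : 0 < Re v < Re s by rewrite v0/=; move: sv0; rewrite cReD cReN; lra.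
  have k0 : 0 < Num.min (Re v) (Re s - Re v) by rewrite lt_min v0/=; lra.
  apply: le_cintegrable (integrable_expR_abs k0).
    apply: cmeasurable_cexp; apply: cmeasurableD.
      by apply: cmeasurableM; [exact: cmeasurable_cst|exact: cmeasurable_real].
    apply: cmeasurableN; apply: cmeasurableM; first exact: cmeasurable_cst.
    have m1 : measurable_fun setT (fun u : R => 1 + expR u).
      by apply: measurable_funD => //; exact: measurable_expR.
    by apply: cmeasurable_real; exact: (measurableT_comp (@measurable_ln R) m1).
  move=> u; rewrite normc_cexp cReD cReN !cReM /= !mulr0 !subr0.
  exact: expR_beta_bound.
rewrite -cintegralZl//.
apply: eq_cintegral => u; rewrite (eq_cintegral (fE ^~ u)).
rewrite cintegralZl; last exact: shift.
by rewrite (cintegral_shift _ (cintegrable_gammak s0)) mulrC.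
Qed.

End Gamma.

(** * The beta integrand on horizontal lines of the strip |Im z| < pi *)

Section BetaKernel.
Variable R : realType.
Notation mu := (@lebesgue_measure R).
Implicit Types (s v : R[i]) (p u t x : R).

Lemma normc_1Dcexp p u : normc (1 + cexp (u +i* p)) ^+ 2 =
  1 + 2 * expR u * cos p + expR u ^+ 2.
Proof.
rewrite normc_sqr cReD cImD Re_cexp Im_cexp /= add0r.
have := cos2Dsin2 p; set c := cos p; set sn := sin p => h.
have -> : (expR u * sn) ^+ 2 = expR u ^+ 2 * (1 - c ^+ 2) by rewrite exprMn -h; ring.
by ring.
Qed.

Lemma slit_1Dcexp p u : - pi < p < pi -> slit_plane (1 + cexp (u +i* p)).
Proof.
move=> /andP[p1 p2]; have [p0|p0|->] := ltgtP p 0.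
- right; rewrite cImD Im_cexp /= add0r mulf_neq0//; first by rewrite gt_eqF ?expR_gt0.
  by rewrite lt_eqF// -oppr_gt0 -sinN sin_gt0_pi//; lra.
- right; rewrite cImD Im_cexp /= add0r mulf_neq0 ?gt_eqF ?expR_gt0//.
  by rewrite sin_gt0_pi//; lra.
- by left; rewrite cReD Re_cexp /= cos0 mulr1 ltr_wpDr ?expR_ge0.
Qed.

(** The difference of the two sides is a square times 1 - cos p. This keeps 1 + e^(u + i p) away
    from 0 at the scale 1 + e^u, uniformly in u; the constant degenerates only as |p| approaches
    pi. *)
Lemma normc_1Dcexp_ge p u :
  (1 + cos p) / 2 * (1 + expR u) ^+ 2 <= normc (1 + cexp (u +i* p)) ^+ 2.
Proof.
rewrite normc_1Dcexp -subr_ge0.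
have -> : 1 + 2 * expR u * cos p + expR u ^+ 2 - (1 + cos p) / 2 * (1 + expR u) ^+ 2 =
   (1 - cos p) / 2 * (1 - expR u) ^+ 2 by field.
by rewrite mulr_ge0 ?sqr_ge0// divr_ge0// subr_ge0 cos_le1.
Qed.

Lemma cos_gtN1 x : - pi < x < pi -> -1 < cos x.
Proof.
move=> /andP[x1 x2]; rewrite -(cos_norm x) -cospi ltr_cos ?in_itv/= ?normr_ge0 ?pi_ge0 ?lexx//.
- by rewrite ltr_norml x1 x2.
- by apply: ltW; rewrite ltr_norml x1 x2.
Qed.

Lemma ler_cos_norm x p : `|p| <= x -> x <= pi -> cos x <= cos p.
Proof.
move=> px xp; rewrite -(cos_norm p).
have [<-//|ne] := eqVneq `|p| x.
have lt : `|p| < x by rewrite lt_neqAle ne.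
apply: ltW; rewrite ltr_cos ?in_itv/= ?normr_ge0//=; first lra.
by have := normr_ge0 p; lra.
Qed.

Definition betak s v p u : R[i] :=
  cexp (v * (u +i* p) - s * clog (1 + cexp (u +i* p))).

(** The derivative of e^(v z) (1 + e^z)^(-s) at z = u + i p. The factor e^z / (1 + e^z) is written
    as one exponential, so that it is [betak 1 1] and inherits its measurability. *)
Definition dbetak s v p u : R[i] :=
  (v - s * cexp ((u +i* p) - clog (1 + cexp (u +i* p)))) * betak s v p u.

(** Stated along any differentiable path in the strip, so that a single computation yields the
    horizontal and the vertical derivative, the two related as [contour_shift] asks. *)
Lemma betak_derive s v (z : R -> R[i]) x d : is_cderive z x d -> - pi < Im (z x) < pi ->
  is_cderive (fun t => cexp (v * z t - s * clog (1 + cexp (z t)))) x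
   (d * ((v - s * cexp (z x - clog (1 + cexp (z x)))) *
         cexp (v * z x - s * clog (1 + cexp (z x))))).
Proof.
move=> dz zx.
have sl : slit_plane (1 + cexp (z x)).
  by have := slit_1Dcexp (Re (z x)) zx; case: (z x).
apply: is_cderive_eq.
  apply: is_cderive_cexp; apply: is_cderiveD.
    exact: is_cderiveM (is_cderive_cst v x) dz.
  apply: is_cderiveN; apply: is_cderiveM (is_cderive_cst s x) _.
  apply: is_cderive_clog sl.
  exact: is_cderiveD (is_cderive_cst 1 x) (is_cderive_cexp dz).
rewrite cexpD cexpN clogK ?slit_neq0//.
by field; exact: slit_neq0.
Qed.

Lemma is_cderive_betak s v p u : - pi < p < pi ->
  is_cderive (betak s v p) u (dbetak s v p u).
Proof.
move=> hp; have hz : is_cderive (fun t : R => t +i* p) u 1.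
  by split; [exact: is_derive_id|exact: is_derive_cst].
by have := betak_derive s v hz hp; rewrite mul1r.
Qed.

Lemma is_cderive_betak_im s v p u : - pi < p < pi ->
  is_cderive (betak s v ^~ u) p ('i%C * dbetak s v p u).
Proof.
move=> hp; have hz : is_cderive (fun t : R => u +i* t) p 'i%C.
  by split; [exact: is_derive_cst|exact: is_derive_id].
by have := betak_derive s v hz hp.
Qed.

Lemma cmeasurable_betak s v p : - pi < p < pi -> cmeasurable (betak s v p).
Proof. by move=> hp; apply: is_cderive_measurable => u; exact: is_cderive_betak. Qed.

Lemma cmeasurable_dbetak s v p : - pi < p < pi -> cmeasurable (dbetak s v p).
Proof.
move=> hp; apply: cmeasurableM; last exact: cmeasurable_betak.
apply: cmeasurableD; first exact: cmeasurable_cst.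
apply: cmeasurableN; apply: cmeasurableM; first exact: cmeasurable_cst.
rewrite (_ : (fun u => _) = betak 1 1 p).
  exact: cmeasurable_betak.
by apply/funext => u; rewrite /betak !mul1r.
Qed.

(** The argument of 1 + e^z contributes at most |Im s| pi, and [normc_1Dcexp_ge] replaces |1 + e^z|
    by 1 + e^u. The imaginary part of v enters only through e^(-Im v p), which is the source of the
    decay in Im v. *)
Lemma betak_bound s v p u x : 0 < Re v < Re s -> `|p| <= x -> 0 < x < pi ->
  normc (betak s v p u) <=
  expR (- (Im v * p)) * (expR (`|Im s| * pi - Re s / 2 * ln ((1 + cos x) / 2)) *
    expR (- (Num.min (Re v) (Re s - Re v) * `|u|))).
Proof.
move=> vs px /andP[x0 xpi].
have hp : - pi < p < pi by rewrite -ltr_norml; lra.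
have sl := slit_1Dcexp u hp.
have hx : - pi < x < pi by lra.
have kap : 0 < (1 + cos x) / 2 by have := cos_gtN1 hx; lra.
have n0 : 0 < normc (1 + cexp (u +i* p)) by rewrite normc_gt0 slit_neq0.
have p0 : 0 < 1 + expR u by rewrite ltr_wpDr ?expR_ge0.
rewrite /betak normc_cexp.
apply: (@le_trans _ _ (expR (- (Im v * p)) * (expR (`|Im s| * pi - Re s / 2 * ln ((1 + cos x) / 2)) *
   expR (Re v * u - Re s * ln (1 + expR u))))); last first.
  by rewrite ler_wpM2l ?expR_ge0// ler_wpM2l ?expR_ge0// expR_beta_bound.
rewrite -!expRD ler_expR cReD cReN !cReM clogE /=.
have arg : Im s * carg (1 + cexp (u +i* p)) <= `|Im s| * pi.
  apply: le_trans (ler_norm _) _; rewrite normrM ler_wpM2l//.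
  have := clog_slit_Im sl; rewrite clogE /= => /andP[a1 a2].
  by rewrite ler_norml !ltW.
have lnw : ln ((1 + cos x) / 2) + 2 * ln (1 + expR u) <= 2 * ln (normc (1 + cexp (u +i* p))).
  have -> : 2 * ln (1 + expR u) = ln ((1 + expR u) ^+ 2) by rewrite lnXn// mulr_natl.
  have -> : 2 * ln (normc (1 + cexp (u +i* p))) = ln (normc (1 + cexp (u +i* p)) ^+ 2).
    by rewrite lnXn// mulr_natl.
  have q0 : 0 < (1 + cos x) / 2 * (1 + expR u) ^+ 2.
    by apply: mulr_gt0 => //; exact: exprn_gt0.
  rewrite -lnM ?posrE ?exprn_gt0// ler_ln ?posrE ?exprn_gt0//.
  apply: le_trans _ (normc_1Dcexp_ge p u).
  rewrite ler_wpM2r ?sqr_ge0//.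
  by have := ler_cos_norm px (ltW xpi); lra.
have s0 : 0 <= Re s / 2 by lra.
have := ler_wpM2l s0 lnw; lra.
Qed.

Lemma dbetak_factor_bound s v p u x : `|p| <= x -> 0 < x < pi ->
  normc (v - s * cexp ((u +i* p) - clog (1 + cexp (u +i* p)))) <=
  normc v + normc s * (Num.sqrt ((1 + cos x) / 2))^-1.
Proof.
move=> px /andP[x0 xpi].
have hp : - pi < p < pi by rewrite -ltr_norml; lra.
have hx : - pi < x < pi by lra.
have kap : 0 < (1 + cos x) / 2 by have := cos_gtN1 hx; lra.
have sl := slit_1Dcexp u hp.
have n0 : 0 < normc (1 + cexp (u +i* p)) by rewrite normc_gt0 slit_neq0.
apply: le_trans (normcD _ _) _; rewrite (normcN (s * _)) normcM lerD2l.
rewrite ler_wpM2l ?normc_ge0// cexpD cexpN clogK ?slit_neq0// normcM normcV normc_cexp /=.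
have sq0 : 0 < Num.sqrt ((1 + cos x) / 2) by rewrite sqrtr_gt0.
rewrite ler_pdivrMr// mulrC ler_pdivlMr//.
have p0 : 0 <= expR u by exact: expR_ge0.
have p1 : 0 <= 1 + expR u by lra.
apply: (@le_trans _ _ (Num.sqrt ((1 + cos x) / 2) * (1 + expR u))).
  by rewrite mulrC ler_wpM2l ?(ltW sq0)//; lra.
rewrite -(@ler_pXn2r _ 2) ?nnegrE ?mulr_ge0 ?(ltW sq0) ?(ltW n0)//.
rewrite exprMn sqr_sqrtr ?(ltW kap)//; apply: le_trans _ (normc_1Dcexp_ge p u).
rewrite ler_wpM2r ?sqr_ge0//.
by have := ler_cos_norm px (ltW xpi); lra.
Qed.

Lemma cintegrable_betak s v p : 0 < Re v < Re s -> - pi < p < pi ->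
  cintegrable setT (betak s v p).
Proof.
move=> vs hp.
have px : `|p| < pi by rewrite ltr_norml.
have k0 : 0 < Num.min (Re v) (Re s - Re v) by rewrite lt_min; lra.
have hx : 0 < (`|p| + pi) / 2 < pi by have := normr_ge0 p; have := pi_gt0 R; lra.
have ph : `|p| <= (`|p| + pi) / 2 by lra.
apply: le_cintegrable (cmeasurable_betak _ _ hp) (fun u => betak_bound u vs ph hx) _.
under eq_fun do rewrite mulrA; exact: integrable_cst_expR_abs.
Qed.

Lemma cintegral_betak s v p : 0 < Re v < Re s -> - pi < p < pi ->
  cintegral setT (betak s v p) = cintegral setT (betak s v 0).
Proof.
move=> vs hp; have := pi_gt0 R => pi0.
have px : `|p| < pi by rewrite ltr_norml.
have pn := normr_ge0 p.
(* Midway between |p| and pi: the strip contains the heights 0 and p, and its closure avoids the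
   singular heights pi and -pi. *)
pose x := (`|p| + pi) / 2.
have hx : 0 < x < pi by rewrite /x; lra.
have k0 : 0 < Num.min (Re v) (Re s - Re v) by rewrite lt_min; lra.
pose A := expR (`|Im v| * x) * expR (`|Im s| * pi - Re s / 2 * ln ((1 + cos x) / 2)).
(* The summand 1 covers [betak], the other one its derivative [dbetak]. *)
pose C := A * (1 + (normc v + normc s * (Num.sqrt ((1 + cos x) / 2))^-1)).
have A0 : 0 <= A by rewrite mulr_ge0 ?expR_ge0.
have M0 : 0 <= normc v + normc s * (Num.sqrt ((1 + cos x) / 2))^-1.
  by rewrite addr_ge0 ?mulr_ge0 ?normc_ge0 ?invr_ge0 ?sqrtr_ge0.
have bb q u : - x < q < x -> normc (betak s v q u) <= A * expR (- (Num.min (Re v) (Re s - Re v) * `|u|)).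
  move=> hq; have qx : `|q| <= x by rewrite ltW// ltr_norml.
  apply: le_trans (betak_bound u vs qx hx) _.
  rewrite mulrA ler_wpM2r ?expR_ge0// ler_wpM2r ?expR_ge0// ler_expR.
  by apply: le_trans (ler_norm _) _; rewrite normrN normrM ler_wpM2l.
have xpi q : - x < q < x -> - pi < q < pi by lra.
apply: (@contour_shift R (betak s v) (dbetak s v) (- x) x C (Num.min (Re v) (Re s - Re v)) k0).
- by move=> q u /xpi hq; exact: is_cderive_betak.
- by move=> q u /xpi hq; exact: is_cderive_betak_im.
- by move=> q /xpi hq; exact: cmeasurable_dbetak.
- move=> q u hq; apply: le_trans (bb _ _ hq) _.
  by rewrite ler_wpM2r ?expR_ge0// /C; nra.
- move=> q u hq; rewrite normcM.
  have qx : `|q| <= x by rewrite ltW// ltr_norml.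
  apply: le_trans (ler_pM (normc_ge0 _) (normc_ge0 _) (dbetak_factor_bound s v u qx hx) (bb _ _ hq)) _.
  rewrite mulrA ler_wpM2r ?expR_ge0// /C; nra.
- by rewrite -ltr_norml /x; lra.
- by move: hx; lra.
Qed.

Lemma betak_real s v u : betak s v 0 u = cexp (v * u%:C - s * (ln (1 + expR u))%:C).
Proof.
rewrite /betak -[u +i* 0]/(u%:C) cexp_real.
have -> : 1 + (expR u)%:C = (1 + expR u)%:C :> R[i] by rewrite rmorphD rmorph1.
by rewrite clog_real// ltr_wpDr ?expR_ge0.
Qed.

Lemma cGamma_betak s v : 0 < Re v < Re s ->
  cGamma v * cGamma (s - v) = cGamma s * cintegral setT (betak s v 0).
Proof.
move=> /andP[v0 vs]; have sv : 0 < Re (s - v) by rewrite cReD cReN subr_gt0.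
rewrite (cGamma_beta v0 sv).
by congr (_ * _); apply: eq_cintegral => u; rewrite betak_real.
Qed.

(** The integral does not depend on the height, so it can be estimated at p + eta when t >= 0 and at
    p - eta when t < 0. Either way e^(t p) times the factor e^(-t q) of that height q is e^(-eta
    |t|). *)
Lemma cintegral_betak_decay s x p : 0 < x < Re s -> - pi < p < pi ->
  exists C k, [/\ 0 < k, 0 <= C & forall t,
   expR (t * p) * normc (cintegral setT (betak s (x +i* t) 0)) <= C * expR (- (k * `|t|))].
Proof.
move=> xs hp; have := pi_gt0 R => pi0.
have px : `|p| < pi by rewrite ltr_norml.
have pn := normr_ge0 p.
pose P := (`|p| + pi) / 2.
have hP : 0 < P < pi by rewrite /P; lra.
pose k := Num.min x (Re s - x).
have k0 : 0 < k by rewrite lt_min; lra.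
pose A := expR (`|Im s| * pi - Re s / 2 * ln ((1 + cos P) / 2)).
pose M := \int[mu]_u expR (- (k * `|u|)).
have M0 : 0 <= M by apply: Rintegral_ge0 => u _; exact: expR_ge0.
(* Small enough for p + eta and p - eta to stay within [-P, P], where [A] is a common constant. *)
pose eta := (pi - `|p|) / 4.
have eta0 : 0 < eta by rewrite /eta; lra.
have bnd t q : `|q| <= P -> normc (cintegral setT (betak s (x +i* t) 0)) <=
    2 * (expR (- (t * q)) * A * M).
  move=> qP; have hq : - pi < q < pi by rewrite -ltr_norml; lra.
  rewrite -(@cintegral_betak s (x +i* t) q)//.
  apply: le_trans (le_normc_cintegral _) _; first exact: cintegrable_betak.
  rewrite ler_wpM2l// -RintegralZl//; last exact: integrable_expR_abs.
  apply: le_Rintegral => //.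
  - by apply: integrable_normc; exact: cintegrable_betak.
  - exact: integrable_cst_expR_abs.
  - by move=> u _; have := @betak_bound s (x +i* t) q u P xs qP hP; rewrite mulrA.
exists (2 * (A * M)), eta; split => //.
  by rewrite !mulr_ge0// ?expR_ge0.
move=> t.
have step q : `|q| <= P -> t * p - t * q = - (eta * `|t|) ->
    expR (t * p) * normc (cintegral setT (betak s (x +i* t) 0)) <= 2 * (A * M) * expR (- (eta * `|t|)).
  move=> qP <-; apply: le_trans (ler_wpM2l (expR_ge0 _) (bnd t q qP)) _.
  by rewrite expRD le_eqVlt; apply/orP; left; apply/eqP; ring.
have [t0|t0] := leP 0 t.
  apply: (step (p + eta)); last by rewrite ger0_norm//; ring.
  by apply: le_trans (ler_normD _ _) _; rewrite (gtr0_norm eta0) /P /eta; lra.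
apply: (step (p - eta)); last by rewrite ltr0_norm//; ring.
by apply: le_trans (ler_normB _ _) _; rewrite (gtr0_norm eta0) /P /eta; lra.
Qed.

(** The transform is even continuous in t, since |g| dominates the integrand for all t. *)
Lemma cmeasurable_fourier (g : R -> R[i]) : cintegrable setT g ->
  cmeasurable (fun t => cintegral setT (fun u => g u * cexp (0 +i* (t * u)))).
Proof.
move=> ig; have mg := cintegrable_measurable ig.
have key (f : R -> R -> R) : (forall t, measurable_fun setT (f t)) ->
   (forall u, continuous (f ^~ u)) -> (forall t u, `|f t u| <= normc (g u)) ->
   measurable_fun setT (fun t => \int[mu]_u f t u).
  move=> mf cf fg; apply: continuous_measurable_fun => a.
  have := @continuity_under_integral R _ _ mu f setT measurableT (a - 1) (a + 1).
  move=> /(_ _ _ (fun u => normc (g u)) (integrable_normc ig)) H; apply: H.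
  - move=> t _; apply: le_integrable (integrable_normc ig) => //.
      by apply/measurable_EFinP; exact: mf.
    by move=> u _ /=; rewrite lee_fin (ger0_norm (normc_ge0 _)).
  - by apply: aeW => u _ t _; exact: cf.
  - by move=> t _; apply: aeW => u _; exact: fg.
  - by rewrite inE/= in_itv/=; lra.
have mK t : cmeasurable (fun u => g u * cexp (0 +i* (t * u))).
  by apply: cmeasurableM => //; apply: cmeasurable_cexp_im; exact: measurable_funM.
have cK u t : exists d, is_cderive (fun t => g u * cexp (0 +i* (t * u))) t d.
  have h : is_cderive (fun t : R => (0 : R) +i* (t * u)) t (0 +i* u).
    split; first exact: is_derive_cst.
    by apply: is_derive_eq; rewrite /GRing.scale /=; ring.
  eexists; exact: is_cderiveM (is_cderive_cst _ _) (is_cderive_cexp h).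
have nK t u : normc (g u * cexp (0 +i* (t * u))) = normc (g u).
  by rewrite normcM normc_cexp_im mulr1.
split => /=.
- apply: (key (fun t u => Re (g u * cexp (0 +i* (t * u))))).
  + by move=> t; exact: (mK t).1.
  + by move=> u t; have [d /is_cderive_continuous[]] := cK u t.
  + by move=> t u; rewrite -(nK t u) le_Re_normc.
- apply: (key (fun t u => Im (g u * cexp (0 +i* (t * u))))).
  + by move=> t; exact: (mK t).2.
  + by move=> u t; have [d /is_cderive_continuous[]] := cK u t.
  + by move=> t u; rewrite -(nK t u) le_Im_normc.
Qed.

End BetaKernel.

(** * The Mellin-Barnes formula *)

Section MellinBarnes.
Variable R : realType.
Notation mu := (@lebesgue_measure R).
Implicit Types (s v z : R[i]) (p u t x y : R).

(** This is a^(-v) Gamma(v) Gamma(s - v) at v = x + i t. The base a = e^(y + i p) is given by its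
    logarithm, so that a positive factor merely translates [y]. *)
Definition mb_integrand s x y p t : R[i] :=
  cexp (- ((x +i* t) * (y +i* p))) * (cGamma (x +i* t) * cGamma (s - (x +i* t))).

(** At height p, e^(v z) splits into e^(x z), e^(i t u) and e^(-t p), so Im v = t becomes the
    frequency. *)
Lemma betak_fourier s x p t : 0 < x < Re s -> - pi < p < pi ->
  cintegral setT (betak s (x +i* t) 0) = (expR (- (t * p)))%:C *
  cintegral setT (fun u => betak s x%:C p u * cexp (0 +i* (t * u))).
Proof.
move=> xs hp; rewrite -(@cintegral_betak _ s (x +i* t) p)// -cintegralZl.
  apply: eq_cintegral => u; rewrite /betak -cexp_real -!cexpD; congr cexp.
  have -> : (x +i* t) * (u +i* p) = x%:C * (u +i* p) + (0 +i* (t * u)) + (- (t * p))%:C.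
    by apply: ReI; rewrite !(cReD, cImD, cReM, cImM) /=; ring.
  by ring.
have hx : 0 < Re x%:C < Re s by [].
apply: le_cintegrable (integrable_normc (cintegrable_betak hx hp)).
  apply: cmeasurableM; first exact: cmeasurable_betak.
  by apply: cmeasurable_cexp_im; exact: measurable_funM.
by move=> u; rewrite normcM normc_cexp_im mulr1.
Qed.

(** The factor e^(t p) of a^(-v) cancels the e^(-t p) of [betak_fourier]; the e^(-i t y) that
    remains is the kernel of Fourier inversion at [y]. *)
Lemma mb_integrandE s x y p t : 0 < x < Re s -> - pi < p < pi ->
  mb_integrand s x y p t = cGamma s * cexp (- (x%:C * (y +i* p))) *
  (cintegral setT (fun u => betak s x%:C p u * cexp (0 +i* (t * u))) *
   cexp (0 +i* (- (t * y)))).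
Proof.
move=> xs hp; rewrite /mb_integrand cGamma_betak// (betak_fourier t xs hp) -cexp_real.
have -> : - ((x +i* t) * (y +i* p)) = - (x%:C * (y +i* p)) + (0 +i* (- (t * y))) - (- (t * p))%:C.
  by apply: ReI; rewrite !(cReD, cImD, cReN, cImN, cReM, cImM) /=; ring.
rewrite cexpD cexpN cexpD; field; exact: cexp_neq0.
Qed.

Lemma cmeasurable_mb s x y p : 0 < x < Re s -> - pi < p < pi ->
  cmeasurable (mb_integrand s x y p).
Proof.
move=> xs hp; rewrite (funext (fun t => mb_integrandE y t xs hp)).
apply: cmeasurableM; first exact: cmeasurable_cst.
apply: cmeasurableM; first by apply: cmeasurable_fourier; exact: cintegrable_betak.
by apply: cmeasurable_cexp_im; apply: measurableT_comp => //; exact: measurable_funM.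
Qed.

Lemma mb_bound s x y p : 0 < x < Re s -> - pi < p < pi ->
  exists C k, [/\ 0 < k, 0 <= C &
    forall t, normc (mb_integrand s x y p t) <= C * expR (- (k * `|t|))].
Proof.
move=> xs hp; have [C [k [k0 C0 ub]]] := cintegral_betak_decay xs hp.
exists (normc (cGamma s) * expR (- (x * y)) * C), k; split => //.
  by rewrite !mulr_ge0// ?expR_ge0 ?normc_ge0.
move=> t; rewrite /mb_integrand cGamma_betak// normcM normc_cexp normcM.
have -> : Re (- ((x +i* t) * (y +i* p))) = - (x * y) + t * p.
  by rewrite cReN cReM /=; ring.
rewrite expRD -!mulrA.
have := ler_wpM2l (mulr_ge0 (normc_ge0 (cGamma s)) (expR_ge0 (- (x * y)))) (ub t).
by congr (_ <= _); ring.
Qed.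

(** Fourier inversion applied to [betak s x%:C p] at [y]; the factor e^(x (y + i p)) of its value
    cancels the prefactor in [mb_integrandE]. *)
Lemma mellin_barnes s x y p : 0 < x < Re s -> - pi < p < pi ->
  cintegral setT (mb_integrand s x y p) =
  (2 * pi)%:C * (cGamma s * cexp (- (s * clog (1 + cexp (y +i* p))))).
Proof.
move=> xs hp; have hx : 0 < Re x%:C < Re s by [].
have [C [k [k0 C0 ub]]] := cintegral_betak_decay xs hp.
pose g := betak s x%:C p.
pose gh t := cintegral setT (fun u => g u * cexp (0 +i* (t * u))).
have ig : cintegrable setT g by exact: cintegrable_betak.
have mgh : cmeasurable gh by exact: cmeasurable_fourier.
have ngh t : normc (gh t) <= C * expR (- (k * `|t|)).
  have := ub t; rewrite (betak_fourier t xs hp) normcM normc_real (ger0_norm (expR_ge0 _)).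
  by rewrite mulrA -expRD subrr expR0 mul1r.
have igh : cintegrable setT gh.
  exact: le_cintegrable mgh ngh (integrable_cst_expR_abs C k0).
have [A [k' [k'0 gA]]] : exists A k', 0 < k' /\ forall u, normc (g u) <= A * expR (- (k' * `|u|)).
  have px : `|p| < pi by rewrite ltr_norml.
  have pn := normr_ge0 p.
  have hP : 0 < (`|p| + pi) / 2 < pi by have := pi_gt0 R; lra.
  have pP : `|p| <= (`|p| + pi) / 2 by lra.
  eexists; exists (Num.min x (Re s - x)); split; first by rewrite lt_min; lra.
  by move=> u; have := betak_bound u hx pP hP; rewrite mulrA; apply.
have A0 : 0 <= A.
  by have := le_trans (normc_ge0 _) (gA 0); rewrite pmulr_lge0 ?expR_gt0.
have gb u : normc (g u) <= A.
  apply: le_trans (gA u) _; rewrite ler_piMr// -expR0 ler_expR oppr_le0.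
  by rewrite mulr_ge0// ltW.
have cg u := is_cderive_continuous (is_cderive_betak s x%:C u hp).
have ih : cintegrable setT (fun t => gh t * cexp (0 +i* (- (t * y)))).
  apply: le_cintegrable (integrable_normc igh).
    apply: cmeasurableM => //; apply: cmeasurable_cexp_im.
    by apply: measurableT_comp => //; exact: measurable_funM.
  by move=> t; rewrite normcM normc_cexp_im mulr1.
have inv := @fourier_inversion R g y A (fun u => (cg u).1) (fun u => (cg u).2) gb ig igh.
rewrite (eq_cintegral (fun t => mb_integrandE y t xs hp)) cintegralZl// inv.
rewrite /g /betak cexpD cexpN; field; exact: cexp_neq0.
Qed.

End MellinBarnes.

(** * Uniform bounds for the partial sums of eta at a real parameter *)

Section AlternatingSeries.
Variable R : realType.
Implicit Types (z : R[i]) (x c : R).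

Lemma normc_signr (n : nat) : normc ((-1) ^+ n : R[i]) = 1.
Proof.
elim: n => [|n IHn]; first by rewrite expr0 normc1.
by rewrite exprS normcM IHn mulr1 (normcN (1 : R[i])) normc1.
Qed.

(** Leibniz's argument for complex terms, by induction in steps of two: the first pair costs at most
    r m - r m.+1, and the rest at most r m.+2 <= r m.+1. *)
Lemma alternating_sum_bound (u : nat -> R[i]) (r : nat -> R) (m n : nat) :
  (forall k, normc (u k - u k.+1) <= r k - r k.+1) ->
  (forall k, normc (u k) <= r k) ->
  normc (\sum_(m <= k < m + n) (-1) ^+ k * u k) <= r m.
Proof.
move=> du ur.
have r0 k : 0 <= r k by apply: le_trans (normc_ge0 _) (ur k).
have dr k : r k.+1 <= r k by rewrite -subr_ge0; apply: le_trans (normc_ge0 _) (du k).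
have [k nk] := ubnP n; elim: k n m nk => // k IHk [|[|n]] m nk.
- by rewrite addn0 big_geq// normc0.
- by rewrite addn1 big_nat1 normcM normc_signr mul1r.
rewrite !addnS big_ltn ?ltnS ?leq_addr ?leqW ?leq_addr// big_ltn ?ltnS ?leq_addr//.
rewrite addrA.
have -> : (-1) ^+ m * u m + (-1) ^+ m.+1 * u m.+1 = (-1) ^+ m * (u m - u m.+1).
  by rewrite exprS; ring.
apply: le_trans (normcD _ _) _; rewrite normcM normc_signr mul1r.
have := IHk n m.+2 _; rewrite !addSn => /(_ (ltnW nk)) h.
by apply: le_trans (lerD (du m) h) _; have := dr m.+1; lra.
Qed.

(** The derivative of e^(-z l) has modulus |z| e^(-Re z l). To use the real mean value theorem, the
    difference d is rotated onto the positive axis by the unit [w]; then [q] is nonincreasing. *)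
Lemma normc_cexp_sub z (l1 l2 : R) : 0 < Re z -> l1 <= l2 ->
  normc (cexp (- (z * l1%:C)) - cexp (- (z * l2%:C))) <=
  normc z / Re z * (expR (- (Re z * l1)) - expR (- (Re z * l2))).
Proof.
move=> z0 l12; set d := _ - _.
have [->|d0] := eqVneq d 0.
  rewrite normc0 mulr_ge0 ?divr_ge0 ?normc_ge0 ?(ltW z0)// subr_ge0 ler_expR lerN2.
  by rewrite ler_wpM2l// ltW.
pose w := (normc d)%:C / d.
have nd : 0 < normc d by rewrite normc_gt0.
have nw : normc w = 1.
  by rewrite normcM normcV normc_real ger0_norm ?normc_ge0// mulfV ?gt_eqF.
have wd : Re (w * d) = normc d by rewrite divfK.
rewrite -wd /d mulrBr cReD cReN.
pose q (l : R) := normc z / Re z * expR (- (Re z * l)) - Re (w * cexp (- (z * l%:C))).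
have dq (l : R) : is_derive l 1 q (- (normc z * expR (- (Re z * l))) + Re (w * (z * cexp (- (z * l%:C))))).
  have h : is_cderive (fun l : R => w * cexp (- (z * l%:C))) l (- (w * (z * cexp (- (z * l%:C))))).
    apply: is_cderive_eq.
      apply: is_cderiveM (is_cderive_cst w l) (is_cderive_cexp (is_cderiveN _)).
      exact: is_cderiveM (is_cderive_cst z l) (is_cderive_real l).
    by move=> /=; ring.
  case: h => h _.
  apply: is_derive_eq; rewrite cReN /GRing.scale /=; field.
  by rewrite gt_eqF.
have [->|ne] := eqVneq l1 l2; first by rewrite !subrr mulr0.
have lt12 : l1 < l2 by rewrite lt_neqAle ne.
have [l _ ] := @MVT _ q _ _ _ lt12 (fun l _ => dq l)
  (derivable_within_continuous (fun l _ => @ex_derive _ _ _ _ _ _ _ (dq l))).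
have : - (normc z * expR (- (Re z * l))) + Re (w * (z * cexp (- (z * l%:C)))) <= 0.
  rewrite addrC subr_le0; apply: le_trans (le_trans (ler_norm _) (le_Re_normc _)) _.
  by rewrite normcM nw mul1r normcM normc_cexp cReN cReM /= mulr0 subr0.
move=> neg; rewrite /q => E.
have : (- (normc z * expR (- (Re z * l))) + Re (w * (z * cexp (- (z * l%:C))))) * (l2 - l1) <= 0.
  by rewrite mulr_le0_ge0// subr_ge0.
by rewrite -E; lra.
Qed.

Lemma ccvg_cauchy (S : nat -> R[i]) (r : nat -> R) :
  r n @[n --> \oo] --> 0 ->
  (forall m n, normc (S (m + n)%N - S m) <= r m) -> exists l, ccvg S l.
Proof.
move=> r0 Sr.
have key (q : nat -> R) : (forall m n, `|q (m + n)%N - q m| <= r m) -> cvg (q n @[n --> \oo]).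
  move=> qr; apply: cauchy_cvg; apply: cauchy_exP => e e0.
  have [N _ Nr] : \forall n \near \oo, `|r n| < e by move/cvgr0Pnorm_lt : r0; exact.
  exists (q N); exists N => // n /= Nn.
  rewrite /ball /= distrC -(subnKC Nn); apply: le_lt_trans (qr N _) _.
  exact: le_lt_trans (ler_norm _) (Nr N (leqnn _)).
have c1 : cvg (Re (S n) @[n --> \oo]).
  apply: key => m n; apply: le_trans _ (Sr m n).
  by apply: le_trans (le_Re_normc _); rewrite cReD cReN.
have c2 : cvg (Im (S n) @[n --> \oo]).
  apply: key => m n; apply: le_trans _ (Sr m n).
  by apply: le_trans (le_Im_normc _); rewrite cImD cImN.
by exists (lim (Re (S n) @[n --> \oo]) +i* lim (Im (S n) @[n --> \oo])); split.
Qed.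

Lemma ccvg_lim (S : nat -> R[i]) (l : R[i]) : ccvg S l ->
  limn (S : nat -> R[i]^o) = l.
Proof.
move=> [S1 S2]; apply: cvg_lim; first exact: norm_hausdorff.
(* In the partial order of [R[i]], a positive [e] has zero imaginary part, so the tolerance is the
   real number [e1]. *)
apply/cvgrPdist_lt => e e0; case: e e0 => e1 e2; rewrite ltcE /= => /andP[/eqP -> e10].
have e12 : 0 < e1 / 2 by rewrite divr_gt0.
move/cvgrPdist_lt : S1 => /(_ _ e12) h1; move/cvgrPdist_lt : S2 => /(_ _ e12) h2.
near=> n.
have a1 : `|Re l - Re (S n)| < e1 / 2 by near: n.
have a2 : `|Im l - Im (S n)| < e1 / 2 by near: n.
have : normc (l - S n) < e1.
  apply: le_lt_trans (le_normc_Re_Im _) _; rewrite cReD cImD cReN cImN; lra.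
by rewrite normc_def -normc_sqrt ltcR.
Unshelve. all: by end_near. Qed.

(* Partial sums of [hurwitz_eta z c] for a real [c]. *)
Definition eta_sum z c (n : nat) : R[i] :=
  \sum_(0 <= k < n) (-1) ^+ k * cexp (- (z * (ln (k%:R + c))%:C)).

(** By [normc_cexp_sub], the decreasing sequence |z| / Re z * (k + c)^(-Re z) meets the requirements
    of [alternating_sum_bound]. The bound is free of n and, for fixed Re z, linear in |z|. *)
Lemma eta_tail_bound z c (m n : nat) : 0 < Re z -> 0 < c ->
  normc (eta_sum z c (m + n) - eta_sum z c m) <=
  normc z / Re z * expR (- (Re z * ln (m%:R + c))).
Proof.
move=> z0 c0; rewrite /eta_sum (big_cat_nat (leq0n m) (leq_addr n m)) /= addrAC subrr add0r.
have pos k : 0 < k%:R + c by rewrite ltr_wpDl.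
(* Thanks to this the sequence also dominates the terms themselves, not only their differences. *)
have K1 : 1 <= normc z / Re z.
  rewrite ler_pdivlMr// mul1r; exact: le_trans (ler_norm _) (le_Re_normc _).
apply: (@alternating_sum_bound (fun k => cexp (- (z * (ln (k%:R + c))%:C)))
  (fun k => normc z / Re z * expR (- (Re z * ln (k%:R + c))))) => k.
  rewrite -mulrBr; apply: normc_cexp_sub => //.
  by rewrite ler_ln ?posrE// lerD2r ler_nat.
rewrite normc_cexp cReN cReM /= mulr0 subr0.
by rewrite ler_peMl ?expR_ge0.
Qed.

Lemma eta_sum_bound z c (n : nat) : 0 < Re z -> 0 < c ->
  normc (eta_sum z c n) <= normc z / Re z * expR (- (Re z * ln c)).
Proof.
move=> z0 c0; have := eta_tail_bound 0 n z0 c0.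
by rewrite add0n [X in _ - X]/eta_sum big_geq// subr0 add0r.
Qed.

Lemma eta_sum_ccvg z c : 0 < Re z -> 0 < c -> exists l, ccvg (eta_sum z c) l.
Proof.
move=> z0 c0.
apply: (ccvg_cauchy (r := fun n => normc z / Re z * expR (- (Re z * ln (n%:R + c))))); last first.
  by move=> m n; exact: eta_tail_bound.
rewrite -[X in _ --> X](mulr0 (normc z / Re z)); apply: cvgM; first exact: cvg_cst.
have h1 := cvg_comp _ _ (@cvgr_idn R) (cvg_addrr c).
have h2 := cvg_comp _ _ h1 (@cvg_ln_pinfty R).
have gm : Re z * x @[x --> +oo%R] --> +oo%R by apply: gt0_cvgMry => //; exact: cvg_id.
have h3 := cvg_comp _ _ h2 gm.
exact: cvg_comp _ _ h3 (@cvgr_expR R).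
Qed.

Lemma hurwitz_eta_ccvg z c : 0 < Re z -> 0 < c ->
  ccvg (eta_sum z c) (hurwitz_eta z c%:C).
Proof.
move=> z0 c0; have [l cl] := eta_sum_ccvg z0 c0.
suff -> : hurwitz_eta z c%:C = l by [].
have E : series (fun k : nat => (-1) ^+ k / cpow (k%:R + c%:C) z : R[i]^o) = eta_sum z c.
  apply/funext => n; rewrite /series /= /eta_sum; apply: eq_bigr => k _.
  have -> : k%:R + c%:C = (k%:R + c)%:C :> R[i] by rewrite rmorphD rmorph_nat.
  by rewrite /cpow clog_real ?ltr_wpDl// cexpN.
by rewrite /hurwitz_eta E; exact: ccvg_lim.
Qed.

End AlternatingSeries.

(** * Gamma has no zero in the right half-plane *)

Section GammaNonzero.
Variable R : realType.
Notation mu := (@lebesgue_measure R).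
Implicit Types (x t l : R) (z : R[i]).

Lemma sqr_sin_le x : sin x ^+ 2 <= x ^+ 2.
Proof.
have key t : 0 < t -> sin t ^+ 2 <= t ^+ 2.
  move=> t0; have [c _] := @MVT _ (@sin R) (@cos R) 0 t t0 (fun x _ => is_derive_sin x)
    (continuous_subspaceT (@continuous_sin R)).
  rewrite sin0 !subr0 => ->; rewrite exprMn ler_piMl ?sqr_ge0//.
have [x0|x0|->] := ltgtP x 0; last by rewrite sin0.
  by have := key (- x); rewrite sinN !sqrrN oppr_gt0; apply.
exact: key.
Qed.

Lemma cos_ge_quadratic x : 1 - x ^+ 2 / 2 <= cos x.
Proof.
have -> : cos x = 1 - 2 * sin (x / 2) ^+ 2.
  have -> : cos x = cos ((x / 2) *+ 2) by congr cos; field.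
  by rewrite cos_mulr2n cos2sin2 mulr2n; ring.
have := sqr_sin_le (x / 2); rewrite expr_div_n; lra.
Qed.

(** For l >= 0, e^l >= (1 + l / 2)^2 and e^(-l) >= 1 - l add up to 2 + l^2 / 4. Exponentials are
    preferred to l^2 because, against the Gamma kernel, they only shift its parameter by 1. *)
Lemma sqr_le_expR l : l ^+ 2 <= 4 * (expR l + expR (- l) - 2).
Proof.
have key t : 0 <= t -> t ^+ 2 <= 4 * (expR t + expR (- t) - 2).
  move=> t0; have h1 : 1 + t / 2 <= expR (t / 2) by exact: expR_ge1Dx.
  have h2 : 1 - t <= expR (- t) by exact: expR_ge1Dx.
  have h3 : expR t = expR (t / 2) ^+ 2 by rewrite expr2 -expRD; congr expR; field.
  have h4 : (1 + t / 2) ^+ 2 <= expR (t / 2) ^+ 2.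
    by rewrite ler_pXn2r ?nnegrE ?expR_ge0//; lra.
  rewrite h3; rewrite sqrrD in h4; lra.
have [l0|l0] := leP 0 l; first exact: key.
by have := key (- l); rewrite sqrrN opprK oppr_ge0 => /(_ (ltW l0)); lra.
Qed.

Definition rgammak x t : R := expR (x * t - expR t).

Lemma gammak_real x t : gammak x%:C t = (rgammak x t)%:C.
Proof. by rewrite /rgammak -cexp_real /gammak rmorphB rmorphM. Qed.

Lemma integrable_rgammak x : 0 < x -> mu.-integrable setT (EFin \o rgammak x).
Proof.
move=> x0; have [i _] := @cintegrable_gammak R x%:C x0.
by apply: eq_integrable i => // t _; rewrite gammak_real.
Qed.

Lemma Rintegral_rgammakE x : \int[mu]_t rgammak x t = Re (cGamma x%:C).
Proof.
rewrite cGammaE -[RHS]/(\int[mu]_t Re (gammak x%:C t)).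
by apply: eq_Rintegral => t _; rewrite gammak_real.
Qed.

Lemma Rintegral_rgammak_add1 x : 0 < x ->
  \int[mu]_t rgammak (x + 1) t = x * \int[mu]_t rgammak x t.
Proof.
move=> x0; rewrite !Rintegral_rgammakE.
have -> : (x + 1)%:C = x%:C + 1 :> R[i] by rewrite rmorphD rmorph1.
by rewrite cGamma_add1// cReM /= mul0r subr0.
Qed.

Lemma Rintegral_rgammak_gt0 x : 0 < x -> 0 < \int[mu]_t rgammak x t.
Proof.
(* The kernel is at least e^(-e) on [0, 1]. *)
move=> x0; pose m : R := expR (- expR 1).
have m0 : 0 < m by exact: expR_gt0.
have iI : mu.-integrable setT (EFin \o (fun t => m * \1_`[0, 1] t)).
  rewrite /comp; under eq_fun do rewrite EFinM.
  by apply: integrableZl => //; exact: integrable_indic_itv.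
apply: (@lt_le_trans _ _ (\int[mu]_t (m * \1_`[0, 1] t))); last first.
  apply: le_Rintegral => //; first exact: integrable_rgammak.
  move=> t _; rewrite indicE; case: (boolP (t \in _)) => [|_]; last first.
    by rewrite mulr0 expR_ge0.
  rewrite inE/= in_itv/= mulr1 => /andP[t0 t1].
  rewrite ler_expR -[leLHS]add0r lerB ?mulr_ge0 ?(ltW x0)//.
  by rewrite ler_expR.
rewrite /Rintegral; under eq_integral do rewrite EFinM.
rewrite integralZl//; last exact: integrable_indic_itv.
have -> : (\int[mu]_t (\1_`[0%R, 1%R] t)%:E)%E = 1%E.
  by rewrite integral_indic//= setIT lebesgue_measure_itv/= lte01 oppr0 adde0.
by rewrite mule1.
Qed.

(* [cos (t * (u - ln x)) >= 1 - 2 t^2 (e^u / x - 2 + x / e^u)], and the right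
   side integrates against the Gamma kernel by the functional equation. *)
Lemma cGamma_neq0_large z : 1 + 2 * Im z ^+ 2 < Re z -> cGamma z != 0.
Proof.
case: z => x t /= xt.
have x1 : 0 < x - 1 by have := sqr_ge0 t; lra.
have x0 : 0 < x by lra.
pose g := \int[mu]_u rgammak x u.
have g0 : 0 < g by exact: Rintegral_rgammak_gt0.
have e1 : \int[mu]_u rgammak (x + 1) u = x * g by exact: Rintegral_rgammak_add1.
have e2 : \int[mu]_u rgammak (x - 1) u = g / (x - 1).
  have := Rintegral_rgammak_add1 x1; rewrite subrK -/g => ->.
  by rewrite mulrC mulKf// gt_eqF.
(* The unit x^(-i t) centers the oscillation at u = ln x, where the kernel [rgammak x] is
   largest. *)
pose c : R[i] := cexp (0 +i* (- (t * ln x))).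
have ig : cintegrable setT (gammak (x +i* t)) by exact: cintegrable_gammak.
have E : Re (c * cGamma (x +i* t)) = \int[mu]_u (rgammak x u * cos (t * (u - ln x))).
  rewrite cGammaE -cintegralZl// -[LHS]/(\int[mu]_u Re (c * gammak (x +i* t) u)).
  apply: eq_Rintegral => u _.
  rewrite /c /gammak -cexpD Re_cexp; congr (expR _ * cos _).
    by rewrite cReD cReD cReN cReM /=; ring.
  by rewrite cImD cImD cImN cImM /=; ring.
have i0 := integrable_rgammak x0.
have i1 : mu.-integrable setT (EFin \o rgammak (x + 1)) by apply: integrable_rgammak; lra.
have i2 := integrable_rgammak x1.
have iZ (k : R) (h : R -> R) : mu.-integrable setT (EFin \o h) ->
    mu.-integrable setT (EFin \o (fun u => k * h u)).
  by move=> ih; rewrite /comp; under eq_fun do rewrite EFinM; exact: integrableZl.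
have iD (h h' : R -> R) : mu.-integrable setT (EFin \o h) -> mu.-integrable setT (EFin \o h') ->
    mu.-integrable setT (EFin \o (fun u => h u + h' u)).
  by move=> ih ih'; rewrite /comp; under eq_fun do rewrite EFinD; exact: integrableD.
pose h u := (1 + 4 * t ^+ 2) * rgammak x u +
  (- (2 * t ^+ 2 / x) * rgammak (x + 1) u + - (2 * t ^+ 2 * x) * rgammak (x - 1) u).
(* The values x g and g / (x - 1) of the shifted integrals almost cancel against 4 t^2; what is left
   is positive since 2 t^2 < x - 1. *)
have ih : \int[mu]_u h u = g * (1 - 2 * t ^+ 2 / (x - 1)).
  rewrite RintegralD//; [|exact: iZ|by apply: iD; exact: iZ].
  rewrite RintegralD//; [|exact: iZ..].
  rewrite !RintegralZl// e1 e2 -/g; field.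
  by rewrite !gt_eqF.
have hle : \int[mu]_u h u <= Re (c * cGamma (x +i* t)).
  rewrite E; apply: le_Rintegral => //.
  - by apply: (iD); [exact: iZ|apply: iD; exact: iZ].
  - have [ic _] := cintegrableZl c ig.
    apply: eq_integrable ic => // u _; congr EFin.
    rewrite /c /gammak -cexpD Re_cexp; congr (expR _ * cos _).
      by rewrite cReD cReD cReN cReM /=; ring.
    by rewrite cImD cImD cImN cImM /=; ring.
  - move=> u _; have r0 : 0 <= rgammak x u by exact: expR_ge0.
    have a1 : rgammak (x + 1) u = rgammak x u * (x * expR (u - ln x)).
      have -> : x * expR (u - ln x) = expR u by rewrite expRB lnK ?posrE// mulrC divfK// gt_eqF.
      by rewrite /rgammak -expRD; congr expR; ring.
    have a2 : rgammak (x - 1) u = rgammak x u * (expR (- (u - ln x)) / x).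
      have -> : expR (- (u - ln x)) / x = expR (- u).
        by rewrite opprB expRB lnK ?posrE// mulrAC divff ?gt_eqF// div1r -expRN.
      by rewrite /rgammak -expRD; congr expR; ring.
    rewrite /h a1 a2.
    have := ler_wpM2l r0 (cos_ge_quadratic (t * (u - ln x))).
    have := ler_wpM2l (sqr_ge0 t) (sqr_le_expR (u - ln x)).
    move=> b1 b2; apply: le_trans b2.
    have -> : (1 + 4 * t ^+ 2) * rgammak x u + (- (2 * t ^+ 2 / x) * (rgammak x u * (x * expR (u - ln x))) +
       - (2 * t ^+ 2 * x) * (rgammak x u * (expR (- (u - ln x)) / x))) =
       rgammak x u * (1 - t ^+ 2 * (4 * (expR (u - ln x) + expR (- (u - ln x)) - 2)) / 2).
      by field; rewrite gt_eqF.
    by rewrite ler_wpM2l// exprMn; lra.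
apply/eqP => z0; move: hle; rewrite z0 mulr0 /= ih; apply/negP; rewrite -ltNge.
rewrite mulr_gt0// subr_gt0 ltr_pdivrMr//; lra.
Qed.

(** By the functional equation a zero at z propagates to every z + n. The imaginary part stays fixed
    meanwhile, so these points end up in the region of [cGamma_neq0_large]. *)
Lemma cGamma_neq0 z : 0 < Re z -> cGamma z != 0.
Proof.
move=> z0; apply/negP => /eqP g0.
have key n : cGamma (z + n%:R) = 0.
  elim: n => [|n IHn]; first by rewrite addr0.
  rewrite -natr1 addrA cGamma_add1 ?IHn ?mulr0//.
  by rewrite cReD -(rmorph_nat (real_complex R)) /= ltr_wpDr.
have := @cGamma_neq0_large (z + (Num.truncn (1 + 2 * Im z ^+ 2)).+1%:R).
rewrite key eqxx cReD cImD -(rmorph_nat (real_complex R)) /= addr0.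
move=> H; apply/notF/H; rewrite -[ltLHS]add0r ltrD// truncnS_gt//.
Qed.

End GammaNonzero.

(** * Finite sums under the integral, the integral of one term, and the summation *)

Section FiniteSums.
Variable R : realType.

Lemma cmeasurable_sum d (T : measurableType d) (f : nat -> T -> R[i]) (n : nat) :
  (forall k, cmeasurable (f k)) -> cmeasurable (fun x => \sum_(0 <= k < n) f k x).
Proof.
move=> mf; elim: n => [|n IHn].
  by under eq_fun do rewrite big_geq//; exact: cmeasurable_cst.
by under eq_fun do rewrite big_nat_recr//=; exact: cmeasurableD.
Qed.

Lemma cintegral_sum (f : nat -> R -> R[i]) (n : nat) :
  (forall k, cintegrable setT (f k)) ->
  cintegrable setT (fun x => \sum_(0 <= k < n) f k x) /\
  cintegral setT (fun x => \sum_(0 <= k < n) f k x) =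
  \sum_(0 <= k < n) cintegral setT (f k).
Proof.
move=> intf; elim: n => [|n [IHn1 IHn2]].
  rewrite big_geq//; under eq_fun do rewrite big_geq//.
  by split; [exact: cintegrable0|exact: cintegral0].
have -> : (fun x => \sum_(0 <= k < n.+1) f k x) = (fun x => \sum_(0 <= k < n) f k x + f n x).
  by apply/funext => x; rewrite big_nat_recr.
by rewrite big_nat_recr//= -IHn2 cintegralD//; split => //; exact: cintegrableD.
Qed.

End FiniteSums.

(** Here a^(-v) c^(v - s) = c^(-s) (a / c)^(-v), so the factor in c only replaces ln |a| by ln |a| -
    ln c in [mellin_barnes]. The resulting c^(-s) (1 + a / c)^(-s) is (c + a)^(-s) because c > 0. *)
Lemma cintegral_mb_term (R : realType) (s a : R[i]) (x c : R) :
  0 < x < complex.Re s -> a != 0 -> - pi < carg a < pi -> 0 < c ->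
  cintegral setT (fun t => mb_integrand s x (ln (normc a)) (carg a) t *
    cexp (- ((s - (x +i* t)) * (ln c)%:C))) =
  (2 * pi)%:C * (cGamma s / cpow (c%:C + a) s).
Proof.
move=> xs a0 ha c0.
pose l := ln c.
have aE : cexp (ln (normc a) +i* carg a) = a by rewrite -clogE clogK.
have step t : mb_integrand s x (ln (normc a)) (carg a) t * cexp (- ((s - (x +i* t)) * l%:C)) =
   cexp (- (s * l%:C)) * mb_integrand s x (ln (normc a) - l) (carg a) t.
  rewrite /mb_integrand mulrAC mulrA -!cexpD; congr (cexp _ * _).
  have -> : (ln (normc a) - l) +i* carg a = (ln (normc a) +i* carg a) - l%:C.
    by apply: ReI; rewrite ?cReD ?cImD ?cReN ?cImN /=; ring.
  by ring.
rewrite (eq_cintegral step) cintegralZl; last first.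
  have [C [k [k0 _ ub]]] := mb_bound (ln (normc a) - l) xs ha.
  exact: le_cintegrable (cmeasurable_mb _ xs ha) ub (integrable_cst_expR_abs C k0).
rewrite mellin_barnes//.
have -> : c%:C + a = c%:C * (1 + cexp ((ln (normc a) - l) +i* carg a)).
  have -> : (ln (normc a) - l) +i* carg a = (ln (normc a) +i* carg a) - l%:C.
    by apply: ReI; rewrite ?cReD ?cImD ?cReN ?cImN /=; ring.
  have cC0 : c%:C != 0 :> R[i] by rewrite -normc_gt0 normc_real gtr0_norm.
  by rewrite cexpD aE cexpN cexp_real /l lnK ?posrE//; field; exact: cC0.
rewrite /cpow clogMr ?slit_neq0//; last exact: slit_1Dcexp.
by rewrite !cexpN (mulrDr s) cexpD -/l invfM; ring.
Qed.

Theorem corollary4 (R : realType) (w : R) (hw : 0 < w) (b : R[i]) (sigma : R)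
    (hsigma0 : 0 < sigma) (hsigmab : sigma < complex.Re b + 1)
    (a : R[i]) (ha0 : a != 0) (harg : - pi < carg a < pi) :
  let F := fun v : R[i] =>
    cpow a (- v) * cGamma v * cGamma (b + 1 - v)
      * hurwitz_eta (b + 1 - v) (w%:C + 2^-1) in
  vline_integrable sigma F /\
  (2 * pi%:C * 'i%C * cGamma (b + 1))^-1 * vline_integral sigma F
    = hurwitz_eta (b + 1) (a + w%:C + 2^-1).
Proof.
move=> F; set s := b + 1; pose c := w + 2^-1.
have c0 : 0 < c by rewrite addr_gt0// invr_gt0.
have cE : w%:C + 2^-1 = c%:C :> R[i].
  by rewrite rmorphD fmorphV rmorph_nat.
have s1 : complex.Re s = complex.Re b + 1 by rewrite cReD.
have xs : 0 < sigma < complex.Re s by rewrite s1 hsigma0.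
have s0 : 0 < complex.Re s by lra.
(* Re (s - v) is constant along the line, so the bound on the partial sums of eta depends on t only
   through |s - v|. *)
pose rho := complex.Re s - sigma.
have rho0 : 0 < rho by rewrite /rho; lra.
have Rv t : complex.Re (s - (sigma +i* t)) = rho by rewrite cReD cReN.
have Rv0 t : 0 < complex.Re (s - (sigma +i* t)) by rewrite Rv.
pose W := mb_integrand s sigma (ln (normc a)) (carg a).
have mW : cmeasurable W by exact: cmeasurable_mb.
have [C [k [k0 C0 ub]]] := mb_bound (ln (normc a)) xs harg.
pose Fn n t := W t * eta_sum (s - (sigma +i* t)) c n.
have FE t : F (sigma +i* t) = W t * hurwitz_eta (s - (sigma +i* t)) c%:C.
  by rewrite /F /W /mb_integrand -/s cE /cpow clogE mulNr !mulrA.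
have mterm l : cmeasurable (fun t : R => cexp (- ((s - (sigma +i* t)) * (ln l)%:C))).
  apply: cmeasurable_cexp; apply: cmeasurableN; apply: cmeasurableM; last exact: cmeasurable_cst.
  apply: cmeasurableD; first exact: cmeasurable_cst.
  by apply: cmeasurableN; split; [exact: measurable_cst|exact: measurable_id].
have mFn n : cmeasurable (Fn n).
  apply: cmeasurableM => //; apply: cmeasurable_sum => j.
  apply: cmeasurableM; [exact: cmeasurable_cst|exact: mterm].
(* The term 2 / k comes from |t| <= (2 / k) e^(k |t| / 2): half of the decay rate k is spent on the
   linear growth in |t|. *)
pose M := (normc s + sigma + 2 / k) / rho * expR (- (rho * ln c)).
have ubF n t : normc (Fn n t) <= C * M * expR (- (k / 2 * `|t|)).
  rewrite normcM.
  have h1 : normc (eta_sum (s - (sigma +i* t)) c n) <= M * expR (k / 2 * `|t|).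
    apply: le_trans (eta_sum_bound n (Rv0 t) c0) _; rewrite Rv.
    have -> : M * expR (k / 2 * `|t|) =
        (normc s + sigma + 2 / k) * expR (k / 2 * `|t|) / rho * expR (- (rho * ln c)).
      by rewrite /M; ring.
    rewrite ler_wpM2r ?expR_ge0// ler_wpM2r ?invr_ge0 ?(ltW rho0)//.
    have h2 : normc (s - (sigma +i* t)) <= normc s + (sigma + `|t|).
      apply: le_trans (normcD _ _) _; rewrite lerD2l (normcN (sigma +i* t)).
      by apply: le_trans (le_normc_Re_Im _) _ => /=; rewrite gtr0_norm.
    have h3 : 1 + k / 2 * `|t| <= expR (k / 2 * `|t|) by exact: expR_ge1Dx.
    have h4 : 0 <= k / 2 * `|t| by rewrite mulr_ge0// divr_ge0// ltW.
    have h5 : `|t| <= 2 / k * expR (k / 2 * `|t|).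
      have -> : `|t| = 2 / k * (k / 2 * `|t|) by field; rewrite gt_eqF.
      have kk : 0 <= 2 / k by rewrite divr_ge0// ltW.
      (* The preceding rewriting also changed |t| inside the exponential on the right, where it is
         restored. *)
      rewrite [in leRHS](_ : 2 / k * (k / 2 * `|t|) = `|t|); last by field; rewrite gt_eqF.
      by rewrite ler_wpM2l//; lra.
    have := normc_ge0 s; nra.
  apply: le_trans (ler_pM (normc_ge0 _) (normc_ge0 _) (ub t) h1) _.
  rewrite mulrACA -expRD le_eqVlt; apply/orP; left; apply/eqP; congr (_ * expR _).
  by field.
have k2 : 0 < k / 2 by rewrite divr_gt0.
have cF t : ccvg (Fn ^~ t) (F (sigma +i* t)).
  by rewrite FE; apply: ccvgM; [exact: ccvg_cst|exact: hurwitz_eta_ccvg].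
have [iF cvF] := cdominated_convergence mFn cF (integrable_cst_expR_abs (C * M) k2) ubF.
split; first exact: iF.
have pi0 : pi != 0 :> R by rewrite gt_eqF// pi_gt0.
have g0 : cGamma s != 0 by exact: cGamma_neq0.
have piC0 : (2 * pi)%:C != 0 :> R[i] by rewrite -normc_gt0 normc_real normr_gt0 mulf_neq0.
pose K : R[i] := (2 * pi)%:C * cGamma s.
have K0 : K != 0 by rewrite mulf_neq0.
pose E n := \sum_(0 <= j < n) ((-1) ^+ j / cpow (j%:R + (a + w%:C + 2^-1)) s).
have FnE n : cintegral setT (Fn n) = K * E n.
  pose f j t := (-1) ^+ j * (W t * cexp (- ((s - (sigma +i* t)) * (ln (j%:R + c))%:C))).
  have -> : Fn n = (fun t => \sum_(0 <= j < n) f j t).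
    apply/funext => t; rewrite /Fn /eta_sum big_distrr/=; apply: eq_bigr => j _.
    by rewrite /f; ring.
  have iW j : cintegrable setT (fun t => W t * cexp (- ((s - (sigma +i* t)) * (ln (j%:R + c))%:C))).
    apply: (le_cintegrable (h := fun t => C * expR (- (rho * ln (j%:R + c))) * expR (- (k * `|t|)))).
    - apply: cmeasurableM => //; exact: mterm.
    - move=> t; rewrite normcM normc_cexp cReN cReM Rv /= mulr0 subr0.
      by rewrite mulrAC ler_wpM2r ?expR_ge0//; exact: ub.
    - exact: integrable_cst_expR_abs.
  have [|_ ->] := @cintegral_sum R f n; first by move=> j; exact: cintegrableZl.
  rewrite /E big_distrr/=; apply: eq_bigr => j _.
  have jc0 : 0 < j%:R + c by rewrite ltr_wpDl.
  rewrite /f cintegralZl// cintegral_mb_term//.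
  have -> : j%:R + (a + w%:C + 2^-1) = (j%:R + c)%:C + a.
    have -> : (j%:R + c)%:C = j%:R + c%:C :> R[i] by rewrite rmorphD rmorph_nat.
    by rewrite -cE; ring.
  by rewrite /K; ring.
(* Since [K] is nonzero, the convergence of the series at the complex parameter a + w + 1/2 is read
   off from that of the integrals of [Fn n]. *)
have cvE : ccvg E (K^-1 * cintegral setT (fun t => F (sigma +i* t))).
  have -> : E = (fun n => K^-1 * cintegral setT (Fn n)).
    by apply/funext => m; rewrite FnE mulKf.
  by apply: ccvgM; [exact: ccvg_cst|exact: cvF].
have -> : hurwitz_eta s (a + w%:C + 2^-1) = K^-1 * cintegral setT (fun t => F (sigma +i* t)).
  exact: ccvg_lim cvE.
have -> : K = 2 * pi%:C * cGamma s by rewrite /K rmorphM rmorph_nat.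
rewrite /vline_integral.
have i0 : 'i%C != 0 :> R[i] by rewrite -normc_gt0 normc_sqrt /= expr0n expr1n add0r sqrtr1.
have pC : pi%:C != 0 :> R[i] by rewrite -normc_gt0 normc_real normr_gt0.
move: (pi%:C) pC => p p0; field.
by rewrite g0 p0 i0.
Qed.
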